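(* Let $(P_m)_{m\ge1}$ be a sequence of finite posets and put $n_m=|P_m|$. Suppose that one of the following holds: (a) $n_m\to\infty$ and $|\min(P_m)|/\log n_m\to\infty$; (b) $\min_{x\in P_m} h(x)\to\infty$; (c) $n_m\to\infty$ and there is a fixed $c>0$ with $w(P_m)\ge c\,n_m$ for all $m$; (d) for each $m$, $P_m=C_m\sqcup A_m$ (a disjoint union of sets, relations between $C_m$ and $A_m$ being allowed), where $C_m$ is a chain of $P_m$, $A_m$ is an antichain of $P_m$, and $|A_m|\to\infty$. Then $\delta(P_m)\to 1/2$.
   Context: For a finite poset $P$ with $n$ elements, a linear extension is an order-preserving bijection $f:P\to\{1,\dots,n\}$, and $f$ denotes a uniformly random linear extension. For distinct $x,y\in P$ let $\delta_{xy}=\min\{\Pr(f(x)<f(y)),\Pr(f(y)<f(x))\}$, and $\delta(P)=\max\delta_{xy}$ over distinct $x,y\in P$. The average height of $x$ is $h(x)=\mathbb{E}f(x)$. $\min(P)$ is the set of minimal elements of $P$, and the width $w(P)$ is the maximum size of an antichain of $P$. Note $\delta(P)\le 1/2$ always. *)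

(* Defs.v *)
From mathcomp Require Import all_boot all_order all_algebra.

Set Implicit Arguments.
Unset Strict Implicit.
Unset Printing Implicit Defensive.

Import Order.TTheory GRing.Theory Num.Theory.
Local Open Scope ring_scope.

Section FinitePosets.
Context {d : Order.disp_t} (P : finPOrderType d).

(* The value f(x) in {1, ..., n} of a linear extension is represented by the *)
(* ordinal f(x) - 1 in 'I_n, where n = #|P|.                                 *)
Definition linext : {set {ffun P -> 'I_#|P|}} :=
  [set f : {ffun P -> 'I_#|P|} |
    [&& injectiveb f,
        [forall i, exists x, f x == i]
      & [forall x, forall y, (x <= y)%O ==> (f x <= f y)%N]]].

Definition minimal_elements : {set P} :=
  [set x | [forall y : P, ~~ (y < x)%O]].

Definition chain (C : {set P}) : bool :=
  [forall x in C, forall y in C, (x >=< y)%O].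

Definition antichain (A : {set P}) : bool :=
  [forall x in A, forall y in A, (x != y) ==> (x >< y)%O].

Definition width : nat := \max_(A : {set P} | antichain A) #|A|.

Definition is_disjoint_union (C A : {set P}) : bool :=
  (C :|: A == [set: P]) && (C :&: A == set0).

Variable R : realFieldType.

Definition prob (E : pred {ffun P -> 'I_#|P|}) : R :=
  #|[set f in linext | E f]|%:R / #|linext|%:R.

Definition expect (X : {ffun P -> 'I_#|P|} -> R) : R :=
  (\sum_(f in linext) X f) / #|linext|%:R.

Definition height (x : P) : R := expect (fun f => (f x).+1%:R).

(* Since height x <= #|P| for every x, the initial value #|P| does not affect *)
(* the minimum unless P is empty, in which case min_height is 0.              *)
Definition min_height : R := \big[Num.min/#|P|%:R]_(x : P) height x.

Definition delta2 (x y : P) : R :=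
  Num.min (prob (fun f => (f x < f y)%N)) (prob (fun f => (f y < f x)%N)).

(* Since delta2 x y >= 0, the initial value 0 does not affect the maximum     *)
(* unless P has at most one element, in which case delta is 0.                *)
Definition delta : R :=
  \big[Num.max/0]_(p : P * P | p.1 != p.2) delta2 p.1 p.2.

End FinitePosets.

Arguments prob {d} P R E.
Arguments expect {d} P R X.
Arguments height {d P} R x.
Arguments min_height {d} P R.
Arguments delta2 {d P} R x y.
Arguments delta {d} P R.

(* Main.v *)
Require Import Defs.
From mathcomp Require Import all_boot all_order all_algebra.
From mathcomp Require Import zify ring lra.

Set Implicit Arguments.
Unset Strict Implicit.
Unset Printing Implicit Defensive.

Import Order.TTheory GRing.Theory Num.Theory.

(* Delete [x] from a uniform linear extension [f]: given the rest, [x] is     *)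
(* uniform on its slots, and [E (1 / slots) = e(P - x) / e(P) =: p_x]. So the *)
(* position of [x] does not concentrate at scales below [1 / p_x].            *)
(*                                                                            *)
(* Strange pigeonhole principle: among sufficiently many elements whose       *)
(* positions are tight and spread out on a common scale, some two are nearly  *)
(* balanced. After bucketing positions, a long sequence in which earlier      *)
(* elements precede later ones with a fixed bias is impossible: averaging the *)
(* occupation vectors over halves would lose a fixed amount of L^2 energy at  *)
(* each dyadic level.                                                         *)
(*                                                                            *)
(* (a), (b): for minimal x, y one has e(P-x) e(P-y) <= e(P) e(P-x-y), whence  *)
(* h(x) <= 1 / p_x, so the position of x lives exactly on the scale 1 / p_x.  *)
(* Dyadic classes of 1 / p_x in [1, n] prove (a); for (b), sum_x p_x = 1 with *)
(* all p_x small forces a large class.                                        *)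
(* (c): E prod_{x in A} 1 / slots(x) <= e(P - A) / e(P) <= 2^n / |A|!, so most *)
(* x in A have order n slots, with high probability.                          *)
(* (d): discard chain elements comparable to everything. Either some x in A   *)
(* is incomparable to many more than |A| chain elements, and is nearly        *)
(* balanced with one of them, or |C| = O(|A|) and (c) applies.                *)

(** Fix [q]. It suffices that, far enough along the sequence, each poset has a [balanced] pair, one
    with |Pr(x before y) - Pr(y before x)| <= 4/2^q: [delta_ge] and [delta_le] then put [delta] in
    [1/2 - 2/2^q, 1/2].

    The main source of such pairs is [balanced_pair]. Suppose many elements live on a common window
    cut into a bounded number of blocks, and each, given the order of the rest, usually has many
    more slots than a block has places. Two of them then rarely share a block ([count_tie]), so
    their order is read off from their blocks, and [strange_pigeonhole] finds two whose blocks show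
    almost no bias.

    Write e for [nlin] and p_x = e(S-x)/e(S). By [count_fib_lt], x has fewer than l slots with
    probability at most l p_x. For minimal x, supermodularity of e gives h(x) <= 1/p_x
    ([sum_index_min]), so minimal elements with p_x of the same dyadic size share a window. With
    many minimal elements some dyadic class is large ([many_minimal_balanced]); if all heights are
    large, all p_x are small yet sum to 1, which again forces a large class
    ([high_minimal_balanced]). For an antichain of linear size the window is the whole range, and
    counting extensions ([sum_count_fib]) shows that at least half of the antichain usually has
    order n slots ([wide_balanced]).

    For a chain and an antichain, let x in A be incomparable to far more than |A| elements c of the
    chain. As c climbs, Pr(x before c) must cross 1/2 in small steps, and x is balanced with the
    element at the crossing ([chain_balanced]). If no such x exists, only O(|A|) chain elements are
    incomparable to anything, and the antichain case applies. *)

Section LinearExtensions.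
Context {d : Order.disp_t} {P : finPOrderType d}.
Implicit Types (S A B : {set P}) (x y z : P) (s g h t : seq P).

(** * Linear extensions as lists, and supermodularity of their number *)

Definition may_precede x y := ~~ (y < x)%O.

(** Extensions are lists over subsets of one fixed poset: deletion stays inside a single type, and
    inductions peel off the head. *)
Definition lin S : seq (seq P) :=
  [seq s <- permutations (enum S) | pairwise may_precede s].

Definition nlin S : nat := size (lin S).

Definition min_of S : {set P} := [set z in S | [forall y in S, ~~ (y < z)%O]].

Definition del x s : seq P := [seq y <- s | y != x].

Definition before S x y : nat :=
  count (fun s => index x s < index y s) (lin S).

Lemma linP S s :
  reflect [/\ uniq s, s =i S & pairwise may_precede s] (s \in lin S).
Proof.
rewrite mem_filter mem_permutations andbC.
apply: (iffP andP) => [[sE ps]|[us sE ps]]; split=> //.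
- by rewrite (perm_uniq sE) enum_uniq.
- by move=> y; rewrite (perm_mem sE) mem_enum.
- by apply: uniq_perm => // [|y]; rewrite ?enum_uniq // sE mem_enum.
Qed.

Lemma lin_uniq S : uniq (lin S).
Proof. exact/filter_uniq/permutations_uniq. Qed.

Lemma size_lin S s : s \in lin S -> size s = #|S|.
Proof.
by case/linP=> us sE _; rewrite -(card_uniqP us); apply: eq_card.
Qed.

Lemma index_lin_lt S s x : s \in lin S -> x \in S -> index x s < #|S|.
Proof. by move=> sl xS; rewrite -(size_lin sl) index_mem; case/linP: sl => _ ->. Qed.

Lemma min_ofP S z :
  reflect (z \in S /\ forall y, y \in S -> ~~ (y < z)%O) (z \in min_of S).
Proof.
rewrite inE; apply: (iffP andP) => [[zS /forallP h]|[zS h]]; split=> //.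
  by move=> y yS; have /implyP := h y; apply.
by apply/forallP => y; apply/implyP/h.
Qed.

Lemma min_of_sub S : min_of S \subset S.
Proof. by apply/subsetP => z /min_ofP[]. Qed.

Lemma min_of_neq0 S : S != set0 -> exists z, z \in min_of S.
Proof.
elim: {S}_.+1 {-2}S (ltnSn #|S|) => // n IH S Sn /set0Pn[x xS].
have [T0|] := eqVneq [set y in S | (y < x)%O] set0.
  exists x; apply/min_ofP; split=> // y yS; apply/negP => yx.
  by have := in_set0 y; rewrite -T0 inE yS yx.
case/IH => [|z /min_ofP[]].
  rewrite -ltnS; apply: leq_trans Sn; rewrite ltnS; apply: proper_card.
  apply/properP; split; first by apply/subsetP => y; rewrite inE => /andP[].
  by exists x; rewrite // inE xS ltxx.
rewrite inE => /andP[zS zx] h; exists z; apply/min_ofP; split=> // y yS.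
apply/negP => yz; have := h y; rewrite inE yS (lt_trans yz zx) => /(_ isT).
by rewrite yz.
Qed.

Lemma cons_lin S z g :
  (z :: g \in lin S) = (z \in min_of S) && (g \in lin (S :\ z)).
Proof.
apply/idP/andP => [/linP[/= /andP[zg ug] zE /andP[pz pg]]|].
  have zS : z \in S by rewrite -zE mem_head.
  split.
    apply/min_ofP; split=> // y; rewrite -zE inE => /predU1P[->|yg].
      by rewrite ltxx.
    exact: (allP pz).
  apply/linP; split=> // y; rewrite !inE -zE inE.
  by case: eqVneq => // ->; rewrite (negPf zg).
case=> /min_ofP[zS hz] /linP[ug gE pg]; apply/linP; split.
- by rewrite /= ug andbT gE !inE eqxx.
- by move=> y; rewrite inE gE !inE; case: eqVneq => [->|].
- rewrite /= pg andbT; apply/allP => y; rewrite gE !inE => /andP[_ yS].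
  exact: hz.
Qed.

Lemma sum_lin_cons S (F : seq P -> nat) : S != set0 ->
  \sum_(s <- lin S) F s =
  \sum_(z in min_of S) \sum_(g <- lin (S :\ z)) F (z :: g).
Proof.
move=> S0.
rewrite (perm_big [seq z :: g | z <- enum (min_of S), g <- lin (S :\ z)]) /=.
  by rewrite big_allpairs_dep /= big_enum.
apply: uniq_perm; first exact: lin_uniq.
  apply: allpairs_uniq_dep => [|z _|]; first exact: enum_uniq.
    exact: lin_uniq.
  by move=> [z g] [z' g'] _ _ /= [-> ->].
move=> s; apply/idP/allpairsPdep => [sl|[z [g [zS gl ->]]]]; last first.
  by rewrite cons_lin gl andbT -mem_enum.
case: s sl => [/linP[_ s0 _]|z g].
  by case/set0Pn: S0 => x; rewrite -s0.
by rewrite cons_lin => /andP[zS gl]; exists z, g; rewrite mem_enum.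
Qed.

Lemma nlin_sum S : nlin S = \sum_(s <- lin S) 1.
Proof. by rewrite sum1_size. Qed.

Lemma nlin_rec S : S != set0 -> nlin S = \sum_(z in min_of S) nlin (S :\ z).
Proof.
move=> S0; rewrite nlin_sum sum_lin_cons //.
by under eq_bigr do rewrite -nlin_sum.
Qed.

Lemma nlin_gt0 S : 0 < nlin S.
Proof.
elim: {S}_.+1 {-2}S (ltnSn #|S|) => // n IH S Sn.
have [->|S0] := eqVneq S set0.
  by rewrite /nlin lt0n size_eq0; apply/eqP => l0; have : [::] \in lin set0;
    [apply/linP; split=> // y; rewrite !inE | rewrite l0].
have [z zm] := min_of_neq0 S0; have zS := subsetP (min_of_sub S) _ zm.
rewrite nlin_rec // (bigD1 z) //= ltn_addr // IH //.
by move: Sn; rewrite (cardsD1 z) zS.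
Qed.

Lemma setD1C S x y : S :\ x :\ y = S :\ y :\ x.
Proof. by rewrite !setDDl setUC. Qed.

(* With [u = D b / (B e)] and [v = D c / (C e)] this is [(1 - u)(1 - v) >= 0]. *)
Lemma quad_ineq (B C D a b c e : nat) : 0 < e ->
  b * c <= a * e -> D * b <= B * e -> D * c <= C * e ->
  D * C * b + D * B * c <= D * D * a + B * C * e.
Proof.
move=> e0 h1 h2 h3; rewrite -(leq_pmul2l e0).
have h4 : (D * b) * (C * e) + (B * e) * (D * c)
    <= (D * b) * (D * c) + (B * e) * (C * e).
  move: (D * b) (B * e) (D * c) (C * e) h2 h3 => p q r t pq rt.
  have -> : q = p + (q - p) by lia.
  have -> : t = r + (t - r) by lia.
  nia.
have h5 : D * D * (b * c) <= D * D * (a * e) by rewrite leq_mul2l h1 orbT.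
lia.
Qed.

(** Induction on |S|. All four counts are expanded by the first element of the extension. Each first
    element z other than x, y is handled by [quad_ineq], fed by the induction hypothesis in S-z, S-x
    and S-y; summing over z gives D (B C) <= D (A D). *)
Lemma nlin_supermodular S x y : x \in min_of S -> y \in min_of S -> x != y ->
  nlin (S :\ x) * nlin (S :\ y) <= nlin S * nlin (S :\ x :\ y).
Proof.
elim: {S}_.+1 {-2}S (ltnSn #|S|) x y => // n IH S Sn x y xm ym xy.
have [xS hx] := min_ofP _ _ xm; have [yS hy] := min_ofP _ _ ym.
have ltn_del (T : {set P}) z : z \in T -> #|T| <= n -> #|T :\ z| < n.
  by move=> zT; rewrite (cardsD1 z T) zT.
pose e (T : {set P}) z := if z \in min_of T then nlin (T :\ z) else 0.
have eE (T : {set P}) : T != set0 -> nlin T = \sum_z e T z.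
  by move=> T0; rewrite nlin_rec // big_mkcond.
have e_split (T : {set P}) : x \in T \/ y \in T ->
    nlin T = e T x + (e T y + \sum_(z | (z != x) && (z != y)) e T z).
  move=> xyT; rewrite eE; last by apply/set0Pn; case: xyT; [exists x | exists y].
  by rewrite (bigD1 x) //= (bigD1 y) //= eq_sym.
set A := nlin S; set B := nlin (S :\ x); set C := nlin (S :\ y).
set D := nlin (S :\ x :\ y).
have DE : D = nlin (S :\ y :\ x) by rewrite /D setD1C.
have ySx : y \in S :\ x by rewrite !inE eq_sym xy.
have xSy : x \in S :\ y by rewrite !inE xy.
have minD (T : {set P}) u v : u \in min_of T -> u != v -> u \in min_of (T :\ v).
  move=> /min_ofP[uT hu] uv; apply/min_ofP; split; first by rewrite !inE uv.
  by move=> w; rewrite !inE => /andP[_ /hu].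
have yx : y != x by rewrite eq_sym.
have AE : A = B + (C + \sum_(z | (z != x) && (z != y)) e S z).
  by rewrite /A e_split; [rewrite /e xm ym | left].
have BE : B = D + \sum_(z | (z != x) && (z != y)) e (S :\ x) z.
  rewrite /B e_split; last by right.
  rewrite {1}/e {1}/e (minD _ _ _ ym yx).
  by case: ifP => // /min_ofP[]; rewrite !inE eqxx.
have CE : C = D + \sum_(z | (z != x) && (z != y)) e (S :\ y) z.
  rewrite /C e_split; last by left.
  rewrite {1}/e {1}/e (minD _ _ _ xm xy) -DE.
  by case: ifP => // /min_ofP[]; rewrite !inE eqxx.
(* The empty set has one extension but no first element, so D cannot be expanded when S = {x, y}. *)
have [Q0|Q0] := eqVneq (S :\ x :\ y) set0.
  have sum0 (T : {set P}) : T \subset S ->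
      \sum_(z | (z != x) && (z != y)) e T z = 0.
    move=> /subsetP TS; apply: big1 => z /andP[zx zy]; rewrite /e.
    case: ifP => // /min_ofP[/TS zS _].
    by have := in_set0 z; rewrite -Q0 !inE zx zy zS.
  move: AE BE CE; rewrite !sum0 ?subsetDl ?subxx // !addn0 => -> -> ->.
  by rewrite leq_mul2r leq_addr orbT.
have DS : D = \sum_(z | (z != x) && (z != y)) e (S :\ x :\ y) z.
  rewrite {1}/D eE // [RHS]big_mkcond /=; apply: eq_bigr => z _.
  rewrite /e; case: ifP => [/min_ofP[]|]; last by case: ifP.
  by rewrite !inE => /andP[-> /andP[->]].
have key z : (z != x) && (z != y) ->
    D * C * e (S :\ x) z + D * B * e (S :\ y) z
      <= D * D * e S z + B * C * e (S :\ x :\ y) z.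
  move=> /andP[zx zy].
  have [zm|zm] := boolP (z \in min_of (S :\ x :\ y)); last first.
    have n1 : z \notin min_of (S :\ x) by apply: contra zm => /minD; apply.
    have n2 : z \notin min_of (S :\ y).
      by apply: contra zm => /minD /(_ zx); rewrite setD1C.
    by rewrite /e (negPf n1) (negPf n2) !muln0.
  have [zS hz] := min_ofP _ _ zm.
  have {}zS : z \in S by move: zS; rewrite !inE => /andP[_ /andP[]].
  rewrite [e (S :\ x :\ y) z]/e zm; apply: quad_ineq; first exact: nlin_gt0.
  - rewrite /e; case: ifP => [zmx|]; last by rewrite mul0n.
    case: ifP => [zmy|]; last by rewrite muln0.
    have zmS : z \in min_of S.
      apply/min_ofP; split=> // w wS.
      have [wx|wx] := eqVneq w x; last first.
        by have [_] := min_ofP _ _ zmx; apply; rewrite !inE wx.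
      by have [_] := min_ofP _ _ zmy; apply; rewrite !inE wx xy.
    rewrite zmS.
    have := IH (S :\ z) (ltn_del _ _ zS Sn) x y.
    rewrite !(setD1C S z) (setD1C (S :\ x) z).
    by apply=> //; apply: minD; rewrite // eq_sym.
  - rewrite /e; case: ifP => [zmx|]; last by rewrite muln0.
    apply: (IH (S :\ x) (ltn_del _ _ xS Sn)) => //; first exact: minD.
    by rewrite eq_sym.
  - rewrite /e; case: ifP => [zmy|]; last by rewrite muln0.
    have := IH (S :\ y) (ltn_del _ _ yS Sn) x z (minD _ _ _ xm xy) zmy.
    by rewrite -DE -/C (setD1C S y x); apply; rewrite eq_sym.
have := leq_sum (index_enum P) key; rewrite !big_split /= -!big_distrr /= -DS => {}key.
have D0 : 0 < D by exact: nlin_gt0.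
rewrite -(leq_pmul2l D0).
move: AE BE CE key D0; clearbody A B C D.
move: (\sum_(z | _) _) (\sum_(z | _) _) (\sum_(z | _) _) => a b c.
move=> -> -> ->; lia.
Qed.

End LinearExtensions.

(** * Deleting an element: heights, slots and ties *)

Section Deletion.
Context {d : Order.disp_t} {P : finPOrderType d}.
Implicit Types (S A B : {set P}) (x y z : P) (s g h t : seq P).

(* The ratio [nlin (S :\ x) / nlin S] is the probability that [x] comes first. *)
Lemma sum_index_min S x : x \in min_of S ->
  (\sum_(s <- lin S) (index x s).+1) * nlin (S :\ x) <= nlin S ^ 2.
Proof.
elim: {S}_.+1 {-2}S (ltnSn #|S|) x => // n IH S Sn x xm.
have [xS hx] := min_ofP _ _ xm.
have S0 : S != set0 by apply/set0Pn; exists x.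
rewrite sum_lin_cons // (bigD1 x) //=.
under eq_bigr do rewrite eqxx.
rewrite -nlin_sum.
have -> : nlin S ^ 2 = nlin S * nlin (S :\ x)
    + nlin S * \sum_(z in min_of S | z != x) nlin (S :\ z).
  by rewrite -mulnDr -mulnn; congr (_ * _); rewrite {1}nlin_rec // (bigD1 x).
have -> : \sum_(z in min_of S | z != x)
      \sum_(g <- lin (S :\ z)) (if z == x then 0 else (index x g).+1).+1
   = \sum_(z in min_of S | z != x)
      (nlin (S :\ z) + \sum_(g <- lin (S :\ z)) (index x g).+1).
  apply: eq_bigr => z /andP[_ /negPf zx].
  by rewrite nlin_sum -big_split /=; apply: eq_bigr => g _; rewrite zx.
rewrite big_split /= addnA.
have -> : nlin (S :\ x) + \sum_(z in min_of S | z != x) nlin (S :\ z) = nlin S.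
  by rewrite [RHS]nlin_rec // [RHS](bigD1 x).
(* What is left is compared for each first element z other than x: the induction hypothesis in S-z,
   combined with supermodularity for the pair z, x. *)
rewrite mulnDl leq_add2l big_distrl big_distrr /=.
apply: leq_sum => z /andP[zm zx].
have zS := subsetP (min_of_sub S) _ zm.
have xz : x != z by rewrite eq_sym.
have xmz : x \in min_of (S :\ z).
  apply/min_ofP; split; first by rewrite !inE xz.
  by move=> y; rewrite !inE => /andP[_ /hx].
have h1 : #|S :\ z| < n by move: Sn; rewrite (cardsD1 z) zS.
have {IH h1} := IH _ h1 _ xmz.
have := nlin_supermodular zm xm zx.
have := nlin_gt0 (S :\ z :\ x).
move: (\sum_(_ <- _) _) (nlin (S :\ z :\ x)) (nlin (S :\ z)) => H e2 ez.
move: (nlin S) (nlin (S :\ x)) => e ex e20 h1 h2.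
rewrite -(leq_pmul2l e20).
have : H * e2 * ex <= ez ^ 2 * ex by rewrite leq_mul2r h2 orbT.
have : ez * (ez * ex) <= ez * (e * e2) by rewrite leq_mul2l h1 orbT.
by rewrite -mulnn; lia.
Qed.

(** Markov's inequality for [sum_index_min]. *)
Lemma count_index_min S x k : x \in min_of S ->
  count (fun s => k <= index x s) (lin S) * k * nlin (S :\ x) <= nlin S ^ 2.
Proof.
move=> /sum_index_min; apply: leq_trans; rewrite leq_mul2r; apply/orP; right.
rewrite -sum1_count big_mkcond /= big_distrl /=.
by apply: leq_sum => s _; case: ifP => // h; rewrite mul1n leqW.
Qed.

Lemma del_cat x s1 s2 : x \notin s1 -> x \notin s2 ->
  del x (s1 ++ x :: s2) = s1 ++ s2.
Proof.
move=> h1 h2; rewrite /del filter_cat /= eqxx /=.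
congr (_ ++ _); apply/all_filterP/allP => y ys.
  by apply: contra h1 => /eqP <-.
by apply: contra h2 => /eqP <-.
Qed.

Lemma index_cat_cons x s1 s2 : x \notin s1 -> index x (s1 ++ x :: s2) = size s1.
Proof. by move=> h; rewrite index_cat (negPf h) /= eqxx addn0. Qed.

Lemma lin_insE S x s1 s2 : x \in S ->
  (s1 ++ x :: s2 \in lin S) =
  [&& s1 ++ s2 \in lin (S :\ x), all (fun y => ~~ (x < y)%O) s1
    & all (fun y => ~~ (y < x)%O) s2].
Proof.
move=> xS.
have pE : pairwise may_precede (s1 ++ x :: s2) =
  [&& pairwise may_precede (s1 ++ s2), all (fun y => ~~ (x < y)%O) s1
    & all (fun y => ~~ (y < x)%O) s2].
  rewrite !pairwise_cat /= allrel_consr.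
  rewrite /may_precede.
  by do ?[case: allrel | case: pairwise | case: all].
have uE : uniq (s1 ++ x :: s2) = (x \notin s1 ++ s2) && uniq (s1 ++ s2).
  by rewrite -cat1s uniq_catCA cat1s cons_uniq.
apply/linP/and3P => [[]|[/linP[us sE ps] h1 h2]].
  rewrite uE pE => /andP[xn us] sE /and3P[ps h1 h2]; split=> //.
  apply/linP; split=> // y; rewrite !inE -sE !(mem_cat, inE).
  by case: eqVneq => [->|//]; move: xn; rewrite mem_cat => /negPf.
have xn : x \notin s1 ++ s2 by rewrite sE !inE eqxx.
rewrite uE pE xn us ps h1 h2; split=> // y.
have := sE y; rewrite !(mem_cat, inE).
by case: eqVneq => [->|//]; rewrite orbT xS.
Qed.

Lemma lin_split S x s : s \in lin S -> x \in S ->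
  exists s1 s2, [/\ s = s1 ++ x :: s2, x \notin s1, x \notin s2
                  & del x s = s1 ++ s2].
Proof.
case/linP=> us sE _ xS.
have xs : x \in s by rewrite sE.
move: us; case/splitPr: {s sE} xs => s1 s2.
rewrite -cat1s uniq_catCA cat1s cons_uniq mem_cat negb_or.
case/andP=> /andP[h1 h2] _; exists s1, s2; split=> //; exact: del_cat.
Qed.

Lemma del_lin S x s : s \in lin S -> x \in S -> del x s \in lin (S :\ x).
Proof.
move=> sl xS; have [s1 [s2 [sE _ _ ->]]] := lin_split sl xS.
by move: sl; rewrite sE lin_insE // => /and3P[].
Qed.

Lemma lin_ins S x g : g \in lin (S :\ x) -> x \in S ->
  exists2 s, s \in lin S & del x s = g.
Proof.
move=> gl xS; have [ug gE pg] := linP _ _ gl.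
(* [x] goes just before the first element above it; by transitivity nothing below [x] comes
   later. *)
pose k := find (fun y => (x < y)%O) g.
have xg : x \notin g by rewrite gE !inE eqxx.
exists (take k g ++ x :: drop k g); last first.
  by rewrite del_cat ?cat_take_drop //; apply: contra xg;
    [exact: mem_take | exact: mem_drop].
rewrite lin_insE // cat_take_drop gl /=; apply/andP; split.
  apply/(all_nthP x) => i; rewrite size_take => ilt.
  have ik : i < k by move: ilt; case: (ltnP k (size g)) => // h /leq_trans; apply.
  by rewrite nth_take //; apply/negbT; exact: (before_find x ik).
case kg : (k < size g); last by rewrite drop_oversize // leqNgt kg.
rewrite (drop_nth x kg) /=.
have xk : (x < nth x g k)%O by rewrite (@nth_find _ x (fun y => (x < y)%O)) // has_find.
rewrite lt_gtF //=; apply/allP => y yd; apply/negP => yx.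
move: pg; rewrite -(cat_take_drop k g) pairwise_cat (drop_nth x kg) /=.
case/and3P=> _ _ /andP[/allP /(_ y yd)]; rewrite /may_precede.
by rewrite (lt_trans yx xk).
Qed.

(* For [g = del x s] this is the number of slots into which [x] may be put    *)
(* when the rest of [s] is kept; given [g], [x] is uniform on these slots.    *)
Definition fib S x g : nat := count (fun s => del x s == g) (lin S).

Lemma fib_gt0 S x g : g \in lin (S :\ x) -> x \in S -> 0 < fib S x g.
Proof.
move=> gl xS; have [s sl sg] := lin_ins gl xS.
by rewrite -has_count; apply/hasP; exists s; rewrite ?sg.
Qed.

Lemma big_lin_del (R : Type) (idx : R) (op : Monoid.com_law idx) S x
    (Q : pred (seq P)) (F : seq P -> R) : x \in S ->
  \big[op/idx]_(s <- lin S | Q s) F s =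
  \big[op/idx]_(g <- lin (S :\ x))
    \big[op/idx]_(s <- lin S | Q s && (del x s == g)) F s.
Proof.
move=> xS; rewrite (exchange_big_dep Q) => [|g s _ /andP[]] //=.
rewrite big_seq_cond [RHS]big_seq_cond; apply: eq_bigr => s /andP[sl Qs].
rewrite Qs /= -big_filter (eq_filter (a2 := pred1 (del x s))); last first.
  by move=> g /=; rewrite eq_sym.
by rewrite filter_pred1_uniq ?lin_uniq ?del_lin // big_seq1.
Qed.

Lemma count_lin_del S x (Q : pred (seq P)) : x \in S ->
  count Q (lin S) =
  \sum_(g <- lin (S :\ x)) count (fun s => Q s && (del x s == g)) (lin S).
Proof.
move=> xS; rewrite -sum1_count (big_lin_del _ _ _ xS).
by apply: eq_bigr => g _; rewrite sum1_count.
Qed.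

Lemma nlin_fib S x : x \in S -> nlin S = \sum_(g <- lin (S :\ x)) fib S x g.
Proof. by move=> xS; rewrite /nlin -count_predT (count_lin_del _ xS). Qed.

(* A linear extension is determined by its deletion of [x] and the index of [x]. *)
Lemma count_fib_le S x g (Q : pred (seq P)) (r : seq nat) : x \in S ->
  (forall s, s \in lin S -> del x s = g -> Q s -> index x s \in r) ->
  count (fun s => Q s && (del x s == g)) (lin S) <= size r.
Proof.
move=> xS h; rewrite -size_filter -(size_map (index x)).
apply: uniq_leq_size.
  rewrite map_inj_in_uniq => [|s t]; first exact/filter_uniq/lin_uniq.
  rewrite mem_filter => /andP[/andP[_ /eqP sg] sl].
  rewrite mem_filter => /andP[/andP[_ /eqP tg] tl].
  have [s1 [s2 [sE s1x s2x gE]]] := lin_split sl xS.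
  have [t1 [t2 [tE t1x t2x]]] := lin_split tl xS.
  rewrite tg -sg gE sE tE !index_cat_cons // => /eqP e st.
  by move: e; rewrite eqseq_cat // => /andP[/eqP -> /eqP ->].
move=> i /mapP[s]; rewrite mem_filter => /andP[/andP[Qs /eqP sg] sl] ->.
exact: h.
Qed.

Lemma fib_le S x g : x \in S -> fib S x g <= #|S|.
Proof.
move=> xS; rewrite -(size_iota 0 #|S|).
apply: (@count_fib_le S x g predT) => // s sl _ _.
by rewrite mem_iota /= add0n (index_lin_lt sl).
Qed.

Lemma nlin_le_del S x : x \in S -> nlin S <= #|S| * nlin (S :\ x).
Proof.
move=> xS; rewrite (nlin_fib xS) nlin_sum big_distrr /=.
by apply: leq_sum => g _; rewrite muln1 fib_le.
Qed.

(** There are e(S-x) fibres, and each one with fewer than [l] slots contributes fewer than [l]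
    extensions. *)
Lemma count_fib_lt S x l : x \in S ->
  count (fun s => fib S x (del x s) < l) (lin S) <= l * nlin (S :\ x).
Proof.
move=> xS; rewrite (count_lin_del _ xS) nlin_sum big_distrr /=.
apply: leq_sum => g _; rewrite muln1.
have [gl|gl] := ltnP (fib S x g) l.
  apply: leq_trans (ltnW gl); apply: sub_count => s /andP[_ ->//].
rewrite (@eq_count _ _ pred0) ?count_pred0 // => s /=.
by case: eqVneq => [->|]; rewrite ?andbF // ltnNge gl.
Qed.

Lemma index_del S x y s : s \in lin S -> x \in S -> y != x ->
  index y s = index y (del x s) + (index x s < index y s).
Proof.
move=> sl xS yx; have [s1 [s2 [-> h1 h2 ->]]] := lin_split sl xS.
rewrite index_cat_cons // !index_cat /= eq_sym (negPf yx).
case: ifP => ys; last by rewrite addnS ltnS leq_addr addn1.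
by rewrite ltnNge ltnW ?addn0 // index_mem.
Qed.

(** Given [del x s], the index of [y] takes at most two consecutive values. A tie thus confines [x]
    to two blocks of [w] places, against at least [l] equally likely slots. *)
Lemma count_tie S x y w l : x \in S -> y != x -> 0 < w ->
  count (fun s => (l <= fib S x (del x s)) && (index x s %/ w == index y s %/ w))
    (lin S) * l <= 2 * w * nlin S.
Proof.
move=> xS yx w0; rewrite (count_lin_del _ xS) (nlin_fib xS).
rewrite big_distrl big_distrr /=; apply: leq_sum => g _.
have [gl|gl] := leqP l (fib S x g); last first.
  rewrite (@eq_count _ _ pred0) ?count_pred0 // => s /=.
  by case: (eqVneq (del x s) g) => [->|]; rewrite ?andbF // leqNgt gl.
apply: leq_mul gl.
set r := iota (w * (index y g %/ w)) w ++ iota (w * ((index y g).+1 %/ w)) w.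
have <- : size r = 2 * w by rewrite size_cat !size_iota mul2n addnn.
apply: count_fib_le => // s sl sg /andP[_ /eqP e].
have := index_del sl xS yx; rewrite sg => iy.
have := divn_eq (index x s) w; have := ltn_pmod (index x s) w0.
move: e; rewrite mem_cat !mem_iota iy => {iy}.
by case: (_ < _); rewrite ?addn0 ?addn1 => ->; nia.
Qed.

End Deletion.

(** * Strange pigeonhole principle via the energy of occupation vectors *)

Section StrangePigeonhole.
Local Open Scope ring_scope.
Variables (R : realFieldType) (T : Type) (I : eqType) (Om : seq T) (K : nat).
Variable Z : I -> T -> nat.
Hypothesis ltZK : forall i w, (Z i w < K)%N.
Implicit Types (l : seq I) (w : T).

Definition order_sign (a b : nat) : R := (a < b)%N%:R - (b < a)%N%:R.

Definition bias i j : R := \sum_(w <- Om) order_sign (Z i w) (Z j w).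

Definition occ l w (k : 'I_K) : R := (count (fun i => Z i w == k) l)%:R.

Definition energy l : R := \sum_(w <- Om) \sum_(k < K) occ l w k ^+ 2.

Lemma order_sign_anti a b : order_sign a b = - order_sign b a.
Proof. by rewrite /order_sign opprB. Qed.

Lemma order_sign_le1 a b : `|order_sign a b| <= 1.
Proof.
rewrite /order_sign; case: ltngtP => _; rewrite ?subrr ?subr0 ?sub0r ?normrN;
  by rewrite ?normr0 ?normr1.
Qed.

Lemma bias_anti i j : bias i j = - bias j i.
Proof. by rewrite -sumrN; apply: eq_bigr => w _; rewrite order_sign_anti. Qed.

Lemma sum_occ l w (F : nat -> R) :
  \sum_(i <- l) F (Z i w) = \sum_(k < K) occ l w k * F k.
Proof.
elim: l => [|i l IH].
  by rewrite big_nil big1 // => k _; rewrite mul0r.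
rewrite big_cons IH (bigD1 (Ordinal (ltZK i w))) //=.
rewrite [RHS](bigD1 (Ordinal (ltZK i w))) //= /occ /= eqxx natrD mulrDl mul1r.
rewrite addrA; congr (_ + _); apply: eq_bigr => k ki.
have /negPf -> : Z i w != k by rewrite eq_sym.
by rewrite add0n.
Qed.

Lemma sum_occ1 l w : \sum_(k < K) occ l w k = (size l)%:R.
Proof.
transitivity (\sum_(k < K) occ l w k * 1); first by under [RHS]eq_bigr do rewrite mulr1.
by rewrite -(sum_occ l w (fun=> 1)) big_const_seq count_predT iter_addr_0.
Qed.

(** By antisymmetry the double sum of [l2] against itself vanishes. Subtracting it leaves only the
    difference of the occupation vectors, paired with signs of size at most 1. *)
Lemma sum_order_sign l1 l2 w :
  \sum_(i <- l1) \sum_(j <- l2) order_sign (Z i w) (Z j w)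
    <= (\sum_(a < K) `|occ l1 w a - occ l2 w a|) * (size l2)%:R.
Proof.
have E l l' : \sum_(i <- l) \sum_(j <- l') order_sign (Z i w) (Z j w) =
    \sum_(a < K) occ l w a * \sum_(b < K) occ l' w b * order_sign a b.
  rewrite (sum_occ l w (fun a => \sum_(j <- l') order_sign a (Z j w))).
  by apply: eq_bigr => a _; rewrite (sum_occ l' w (order_sign a)).
have anti : \sum_(i <- l2) \sum_(j <- l2) order_sign (Z i w) (Z j w) = 0.
  set s := LHS; have : s = - s.
    rewrite {2}/s exchange_big /= -sumrN; apply: eq_bigr => i _.
    by rewrite -sumrN; apply: eq_bigr => j _; rewrite order_sign_anti.
  by lra.
rewrite -[leLHS]subr0 -[X in _ - X]anti !E -sumrB mulr_suml.
apply: ler_sum => a _.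
rewrite -mulrBl; apply: le_trans (ler_norm _) _; rewrite normrM.
apply: ler_wpM2l => //; apply: le_trans (ler_norm_sum _ _ _) _.
rewrite -(sum_occ1 l2 w); apply: ler_sum => b _.
rewrite normrM ger0_norm ?ler0n // ler_piMr ?ler0n //.
exact: order_sign_le1.
Qed.

(** The parallelogram law. *)
Lemma energy_cat l1 l2 :
  energy (l1 ++ l2) = 2 * energy l1 + 2 * energy l2
    - \sum_(w <- Om) \sum_(k < K) (occ l1 w k - occ l2 w k) ^+ 2.
Proof.
rewrite /energy !mulr_sumr -big_split -sumrB /=; apply: eq_bigr => w _.
rewrite !mulr_sumr -big_split -sumrB /=; apply: eq_bigr => k _.
by rewrite /occ count_cat natrD; ring.
Qed.

Lemma energy_ge0 l : 0 <= energy l.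
Proof. by do 2?[apply: sumr_ge0 => ? _]; exact: sqr_ge0. Qed.

Variable eps : R.
Hypothesis eps0 : 0 < eps.

Let N : R := (size Om)%:R.

(** By [sum_order_sign] the bias forces a large L^1 distance between the occupation vectors;
    Cauchy-Schwarz over the [K] buckets and all samples makes it an L^2 distance. *)
Lemma energy_gap l1 l2 h : (0 < h)%N -> size l1 = h -> size l2 = h ->
  (forall i j, i \in l1 -> j \in l2 -> eps * N <= bias i j) ->
  eps ^+ 2 * h%:R ^+ 2 * N
    <= K%:R * \sum_(w <- Om) \sum_(k < K) (occ l1 w k - occ l2 w k) ^+ 2.
Proof.
move=> h0 s1 s2 big_bias; set D := \sum_(w <- Om) _.
pose V := \sum_(w <- Om) \sum_(k < K) `|occ l1 w k - occ l2 w k|.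
have hR : 0 < h%:R :> R by rewrite ltr0n.
have VE : eps * h%:R * N <= V.
  rewrite -(ler_pM2r hR).
  have le1 : eps * h%:R * N * h%:R <= \sum_(i <- l1) \sum_(j <- l2) bias i j.
    apply: (@le_trans _ _ (\sum_(i <- l1) \sum_(j <- l2) eps * N)).
      rewrite !big_const_seq !count_predT !iter_addr_0 s1 s2 -mulrnA.
      by rewrite -[X in _ <= X]mulr_natr natrM; lra.
    rewrite big_seq [leRHS]big_seq; apply: ler_sum => i il.
    rewrite big_seq [leRHS]big_seq; apply: ler_sum => j jl; exact: big_bias.
  apply: le_trans le1 _.
  under eq_bigr do rewrite exchange_big /=.
  rewrite exchange_big /= /V mulr_suml; apply: ler_sum => w _.
  by rewrite -s2; exact: sum_order_sign.
have [K0|K0] := posnP K.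
  have V0 : V = 0.
    apply: big1 => w _; apply: big1 => k _.
    by have := ltn_ord k; rewrite {2}K0.
  move: VE; rewrite V0 -mulrA pmulr_rle0 // pmulr_rle0 // => N0.
  apply: (@le_trans _ _ 0); first by rewrite pmulr_rle0 ?mulr_gt0 ?exprn_gt0.
  rewrite mulr_ge0 ?ler0n //.
  by do 2![apply: sumr_ge0 => ? _]; exact: sqr_ge0.
have KR : 0 < K%:R :> R by rewrite ltr0n.
(* AM-GM: [2 eps h K |W| <= K^2 W^2 + eps^2 h^2] for every difference [W]. *)
have amgm : 2 * eps * h%:R * K%:R * V
    <= K%:R ^+ 2 * D + eps ^+ 2 * h%:R ^+ 2 * K%:R * N.
  have -> : eps ^+ 2 * h%:R ^+ 2 * K%:R * N =
      \sum_(w <- Om) \sum_(k < K) eps ^+ 2 * h%:R ^+ 2.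
    under eq_bigr do rewrite sumr_const card_ord.
    rewrite big_const_seq count_predT iter_addr_0 -[RHS]mulr_natr.
    by rewrite -[in RHS](mulr_natr _ K).
  rewrite /V /D !mulr_sumr -big_split /=; apply: ler_sum => w _.
  rewrite !mulr_sumr -big_split /=; apply: ler_sum => k _.
  rewrite -[X in K%:R ^+ 2 * X]real_normK ?num_real //.
  have := sqr_ge0 (K%:R * `|occ l1 w k - occ l2 w k| - eps * h%:R).
  by rewrite sqrrB !exprMn; lra.
have h1 : 2 * eps * h%:R * K%:R * (eps * h%:R * N) <= 2 * eps * h%:R * K%:R * V.
  by apply: ler_wpM2l VE; rewrite !mulr_ge0 // ltW.
rewrite -(ler_pM2l KR); move: h1 amgm.
rewrite !expr2; clearbody D V; lra.
Qed.

(** Starting from the trivial bound for single elements, each doubling of the list loses a share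
    eps^2/(4K) of the maximal energy, by [energy_cat] and [energy_gap]. *)
Lemma energy_decay r l : (0 < K)%N -> size l = (2 ^ r)%N ->
  pairwise (fun i j => eps * N <= bias i j) l ->
  energy l <= 4 ^+ r * N * (1 - r%:R * (eps ^+ 2 / (4 * K%:R))).
Proof.
move=> K0; have KR : 0 < K%:R :> R by rewrite ltr0n.
elim: r l => [|r IH] l.
  case: l => [|i [|]] // _ _.
  rewrite expr0 mul1r mul0r subr0 mulr1 /energy.
  rewrite /N -sum1_size natr_sum; apply: ler_sum => w _.
  rewrite -[leRHS](sum_occ1 [:: i] w); apply: ler_sum => k _.
  by rewrite /occ /=; case: eqP; rewrite /= ?expr0n ?expr1n.
rewrite expnS mul2n -addnn => sl.
have lE := cat_take_drop (2 ^ r) l.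
have st : size (take (2 ^ r) l) = (2 ^ r)%N by rewrite size_takel // sl leq_addr.
have sd : size (drop (2 ^ r) l) = (2 ^ r)%N by rewrite size_drop sl addnK.
move: (take _ l) (drop _ l) lE st sd => l1 l2 <- s1 s2 {sl}.
rewrite pairwise_cat => /and3P[/allrelP p12 /(IH _ s1) e1 /(IH _ s2) e2].
have r0 : (0 < 2 ^ r)%N by rewrite expn_gt0.
have := energy_gap r0 s1 s2 p12; rewrite energy_cat.
set D := \sum_(w <- Om) _ => gap.
have pw : (2 ^ r)%N%:R ^+ 2 = 4 ^+ r :> R.
  by rewrite natrX -exprM mulnC exprM -natrX.
rewrite pw in gap.
set k := eps ^+ 2 / (4 * K%:R) in e1 e2 *.
have kE : eps ^+ 2 = 4 * k * K%:R.
  by rewrite /k; field; rewrite lt0r_neq0.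
have gap' : 4 * k * 4 ^+ r * N <= D.
  rewrite -(ler_pM2l KR); apply: le_trans gap; rewrite kE; lra.
rewrite exprS -natr1; clearbody D k; lra.
Qed.

(** Ramsey-type recursion: either the head beats 2^k of the others or 2^k of them beat it. It goes
    in front of, or behind, the list found among these. *)
Lemma tournament (e : rel I) k l : uniq l -> (2 ^ k <= size l)%N ->
  {in l &, forall x y, x != y -> e x y || e y x} ->
  exists l', [/\ uniq l', {subset l' <= l}, size l' = k & pairwise e l'].
Proof.
elim: k l => [|k IH] l ul sl tot; first by exists [::].
case: l ul sl tot => [|x l] /=; first by rewrite leqn0 expn_eq0.
case/andP=> xl ul sl tot.
have step (a : pred I) : (2 ^ k <= count a l)%N ->
    exists l', [/\ uniq l', {subset l' <= filter a l}, size l' = k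
                  & pairwise e l'].
  move=> ha; apply: IH; rewrite ?size_filter ?filter_uniq // => y z.
  rewrite !mem_filter => /andP[_ yl] /andP[_ zl].
  by apply: tot; rewrite inE ?yl ?zl orbT.
have [ha|ha] := leqP (2 ^ k) (count (e x) l).
  have [l' [ul' l'l sl' pl']] := step _ ha.
  exists (x :: l'); split.
  - rewrite /= ul' andbT; apply/negP => /l'l.
    by rewrite mem_filter (negPf xl) andbF.
  - move=> y; rewrite !inE => /predU1P[->|/l'l]; first by rewrite eqxx.
    by rewrite mem_filter => /andP[_ ->]; rewrite orbT.
  - by rewrite /= sl'.
  - rewrite /= pl' andbT; apply/allP => y /l'l.
    by rewrite mem_filter => /andP[].
have {}ha : (2 ^ k <= count (predC (e x)) l)%N.
  by have := count_predC (e x) l; move: sl; rewrite expnS; lia.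
have [l' [ul' l'l sl' pl']] := step _ ha.
exists (rcons l' x); split.
- rewrite rcons_uniq ul' andbT; apply/negP => /l'l.
  by rewrite mem_filter (negPf xl) andbF.
- move=> y; rewrite mem_rcons !inE => /predU1P[->|/l'l]; first by rewrite eqxx.
  by rewrite mem_filter => /andP[_ ->]; rewrite orbT.
- by rewrite size_rcons sl'.
- rewrite pairwise_rcons pl' andbT; apply/allP => y /l'l.
  rewrite mem_filter => /andP[/= nxy yl].
  have xy : x != y by apply: contra xl => /eqP ->.
  have := tot x y; rewrite !inE eqxx yl orbT => /(_ isT isT xy).
  by rewrite (negPf nxy).
Qed.

(** Otherwise every pair has a definite bias in one direction; [tournament] extracts a consistently
    biased list of length 2^r, whose energy would be negative by [energy_decay]. *)
Lemma strange_pigeonhole r l : (0 < size Om)%N -> 4 * K%:R < r%:R * eps ^+ 2 ->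
  uniq l -> (2 ^ 2 ^ r <= size l)%N ->
  exists i j, [/\ i \in l, j \in l, i != j & `|bias i j| < eps * N].
Proof.
move=> Om0 rK ul sl.
have [/hasP[i il /hasP[j jl /andP[ij b]]]|] :=
  boolP (has (fun i => has (fun j => (i != j) && (`|bias i j| < eps * N)) l) l).
  by exists i, j.
move=> /hasPn nb; exfalso.
have NR : 0 < N by rewrite ltr0n.
have [|l' [_ l'l sl' pl']] :=
    @tournament (fun i j => eps * N <= bias i j) (2 ^ r) l ul sl.
  move=> i j il jl ij; have /hasPn/(_ j jl) := nb i il.
  rewrite ij /= -leNgt ler_normr -bias_anti //.
have [K0|K0] := posnP K.
  case: l {nb l'l} ul sl => [|i l] _; first by rewrite leqn0 expn_eq0.
  by case: Om Om0 => // w _ _ _; have := ltZK i w; rewrite K0.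
have := le_trans (energy_ge0 _) (energy_decay K0 sl' pl').
rewrite -mulrA pmulr_rge0 ?exprn_gt0 // pmulr_rge0 // subr_ge0.
have KR : 0 < 4 * K%:R :> R by rewrite mulr_gt0 ?ltr0n.
by rewrite mulrA ler_pdivrMr // mul1r leNgt rK.
Qed.

End StrangePigeonhole.

(** * From tight, spread-out positions to a balanced pair *)

Lemma count_cover3 (T : Type) (a b c e : pred T) (r : seq T) :
  (forall s, a s -> [|| b s, c s | e s]) ->
  count a r <= count b r + count c r + count e r.
Proof.
move=> h; elim: r => //= s r; have := h s.
by case: (a s); case: (b s); case: (c s); case: (e s) => //=; lia.
Qed.

Lemma norm_sub_budget (R : realFieldType) (p a b c t n : R) : (0 < p ->
  `|a - b - c| <= t -> p * t <= 3 * n -> p * `|c| <= n -> p * a <= p * b + 4 * n)%R.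
Proof.
move=> p0 /(le_trans (ler_norm _)) h1 h2 h3; have h4 := ler_norm c.
have h5 : (a - b <= `|c| + t)%R by lra.
have := ler_wpM2l (ltW p0) h5; lra.
Qed.

Section Balance.
Context {d : Order.disp_t} {P : finPOrderType d}.
Implicit Types (S A B : {set P}) (x y z : P) (s g h t : seq P).

(** The slack of 4 is the error budget of [balanced_pair]: one unit for the remaining bias of the
    buckets and three for ties. *)
Definition balanced q S x y : Prop :=
  [/\ x \in S, y \in S, x != y,
      2 ^ q * before S x y <= 2 ^ q * before S y x + 4 * nlin S
    & 2 ^ q * before S y x <= 2 ^ q * before S x y + 4 * nlin S].

(** The size that [strange_pigeonhole] requires for [K.+1] buckets and eps = 2^-q: its r must exceed
    4 (K+1) / eps^2. *)
Definition clump q K : nat := 2 ^ 2 ^ (4 * K.+1 * 4 ^ q).+1.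

(** Positions fall into [K] blocks of width [w] and one overflow bucket. Buckets order two elements
    correctly unless they tie. A tie requires overflow, fewer than [l] slots, or a shared block
    despite [l] slots; each has probability at most 2^-q. *)
Lemma balanced_pair q K S xs w l :
  uniq xs -> {subset xs <= S} -> clump q K <= size xs ->
  0 < w -> 2 ^ q.+1 * w <= l ->
  {in xs, forall x,
    2 ^ q * count (fun s => fib S x (del x s) < l) (lin S) <= nlin S} ->
  {in xs, forall x,
    2 ^ q * count (fun s => w * K <= index x s) (lin S) <= nlin S} ->
  exists x y, balanced q S x y.
Proof.
move=> uxs xsS sxs w0 wl hfib htail.
pose Z x s := minn (index x s %/ w) K.
have ltZK x s : Z x s < K.+1 by rewrite ltnS geq_minr.
pose eps : rat := (2 ^+ q)^-1.
have pq : (0 < 2 ^+ q :> rat)%R by rewrite exprn_gt0.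
have e0 : (0 < eps)%R by rewrite invr_gt0.
have rK : (4 * K.+1%:R < (4 * K.+1 * 4 ^ q).+1%:R * eps ^+ 2)%R.
  have -> : (eps ^+ 2 = (4 ^ q)%:R^-1)%R.
    by rewrite /eps exprVn -exprM (mulnC q 2) exprM natrX -natrX.
  by rewrite ltr_pdivlMr ?ltr0n ?expn_gt0 // -natrM -natrM ltr_nat ltnS.
have [x [y [xx yx xy]]] :=
  strange_pigeonhole ltZK e0 (nlin_gt0 S) rK uxs sxs.
rewrite -/(nlin S) => hb.
have xS := xsS _ xx; have yS := xsS _ yx.
pose tie := count (fun s => Z x s == Z y s) (lin S).
have tie_le : 2 ^ q * tie <= 3 * nlin S.
  pose c3 := count (fun s => (l <= fib S x (del x s)) &&
                       (index x s %/ w == index y s %/ w)) (lin S).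
  have h3 : 2 ^ q * c3 <= nlin S.
    have yx' : y != x by rewrite eq_sym.
    have := count_tie l xS yx' w0; rewrite -/c3 => h.
    have {}h : c3 * (2 ^ q.+1 * w) <= 2 * w * nlin S.
      by apply: leq_trans h; rewrite leq_mul2l wl orbT.
    have w20 : 0 < 2 * w by rewrite muln_gt0.
    by rewrite -(leq_pmul2l w20); move: h; rewrite expnS; clear; lia.
  have h12 : tie <= count (fun s => w * K <= index x s) (lin S)
      + count (fun s => fib S x (del x s) < l) (lin S) + c3.
    apply: count_cover3 => s /eqP zE; case: (leqP (w * K)) => //= ix.
    case: ltnP => //= _.
    have lt_x : index x s %/ w < K by rewrite ltn_divLR // mulnC.
    by apply/eqP; move: zE lt_x; rewrite /Z; clear; lia.
  move: (hfib _ xx) (htail _ xx) h12 h3; clear; nia.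
have bE u v : ((before S u v)%:R - (before S v u)%:R =
    \sum_(s <- lin S) order_sign rat (index u s) (index v s))%R.
  rewrite /before -!sum1_count !natr_sum /order_sign sumrB.
  by congr (_ - _)%R; rewrite big_mkcond /=; apply: eq_bigr => s _; case: ifP.
have near : (`|(before S x y)%:R - (before S y x)%:R - bias rat (lin S) Z x y|
    <= tie%:R)%R.
  rewrite bE -sumrB; apply: le_trans (ler_norm_sum _ _ _) _.
  rewrite /tie -sum1_count natr_sum [leRHS]big_mkcond /=.
  apply: ler_sum => s _; case: eqVneq => zE.
    by rewrite zE [X in (_ - X)%R]/order_sign ltnn subrr subr0 order_sign_le1.
  have -> : order_sign rat (index x s) (index y s) =
      order_sign rat (Z x s) (Z y s).
    rewrite /order_sign.
    have := @leq_div2r w (index x s) (index y s).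
    have := @leq_div2r w (index y s) (index x s).
    move: zE; rewrite /Z; move: (_ %/ w) (_ %/ w) => a b zE h1 h2.
    by clear -zE h1 h2; congr (_%:R - _%:R)%R; congr nat_of_bool;
      apply/idP/idP; lia.
  by rewrite subrr normr0.
have tieR : (2 ^+ q * tie%:R <= 3 * (nlin S)%:R :> rat)%R.
  by rewrite -natrX -!natrM ler_nat.
have hbR : (2 ^+ q * `|bias rat (lin S) Z x y| <= (nlin S)%:R)%R.
  by rewrite mulrC -ler_pdivlMr // mulrC ltW.
exists x, y; split=> //; rewrite -(ler_nat rat) natrD !natrM natrX.
  exact: norm_sub_budget pq near tieR hbR.
apply: (@norm_sub_budget _ _ _ _ (- bias rat (lin S) Z x y)) tieR _ => //.
  by rewrite opprK -normrN opprD opprB.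
by rewrite normrN.
Qed.

End Balance.

(** * Minimal elements, classed by the probability of coming first *)

Section Minimal.
Context {d : Order.disp_t} {P : finPOrderType d}.
Implicit Types (S A B : {set P}) (x y z : P) (s g h t : seq P).

(** This many blocks of width 2^(k-2q-1) reach 2^(k+q+1), beyond which Markov's inequality leaves
    probability at most 2^-q. *)
Definition min_clump q : nat := clump q (2 ^ (3 * q + 2)).

(** The integer part of log2(1/p_x); a minimal [x] has its position on the scale 2^[scale S x]. *)
Definition scale S x : nat := trunc_log 2 (nlin S %/ nlin (S :\ x)).

Lemma nlin_del_le S x : x \in S -> nlin (S :\ x) <= nlin S.
Proof.
move=> xS; rewrite (nlin_fib xS) nlin_sum big_seq [X in _ <= X]big_seq.
by apply: leq_sum => g gl; rewrite fib_gt0.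
Qed.

Lemma scaleP S x : x \in S ->
  2 ^ scale S x * nlin (S :\ x) <= nlin S < 2 ^ (scale S x).+1 * nlin (S :\ x).
Proof.
move=> xS; have e0 := nlin_gt0 (S :\ x).
have q0 : 0 < nlin S %/ nlin (S :\ x) by rewrite divn_gt0 // nlin_del_le.
have /andP[h1 h2] := trunc_log_bounds (isT : 1 < 2) q0.
by rewrite -leq_divRL // h1 -ltn_divLR.
Qed.

Lemma clump_ge q K m : m <= 4 * K.+1 * 4 ^ q -> 2 ^ m <= clump q K.
Proof.
move=> h; rewrite leq_exp2l //; apply: leq_trans h _; apply: ltnW.
by apply: leq_trans (ltn_expl _ (isT : 1 < 2)) _; rewrite leq_exp2l.
Qed.

Lemma scale_balanced q S k xs : uniq xs -> {subset xs <= min_of S} ->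
  {in xs, forall x, scale S x = k} -> min_clump q <= size xs ->
  exists x y, balanced q S x y.
Proof.
move=> uxs xsm xsk sxs.
have xsS x : x \in xs -> x \in S by move/xsm/(subsetP (min_of_sub S)).
have lo x : x \in xs -> 2 ^ k * nlin (S :\ x) <= nlin S.
  by move=> xx; have := scaleP (xsS x xx); rewrite xsk // => /andP[].
have hi x : x \in xs -> nlin S < 2 ^ k.+1 * nlin (S :\ x).
  by move=> xx; have := scaleP (xsS x xx); rewrite xsk // => /andP[].
have sz : 2 ^ (2 * q + 1) <= size xs.
  apply: leq_trans sxs; apply: clump_ge.
  have := ltn_expl q (isT : 1 < 4); nia.
(* The block width below must be a true power of 2. Each p_x exceeds 2^-(k+1) and they sum to at
   most 1, so [size xs] is below 2^(k+1). *)
have kq : 2 * q + 1 <= k.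
  have xs0 : 0 < size xs by apply: leq_trans sz; rewrite expn_gt0.
  have S0 : S != set0.
    case: xs xsS xs0 {uxs xsm xsk sxs lo hi sz} => // x xs /(_ x).
    by rewrite mem_head => /(_ isT) xS _; apply/set0Pn; exists x.
  rewrite -ltnS -(ltn_exp2l _ _ (isT : 1 < 2)).
  apply: leq_ltn_trans sz _.
  rewrite -(ltn_pmul2r (nlin_gt0 S)) -sum1_size big_distrl /=.
  have le1 : \sum_(x <- xs) nlin (S :\ x) <= nlin S.
    rewrite big_uniq // [X in _ <= X]nlin_rec // big_mkcond.
    rewrite [X in _ <= X]big_mkcond /=.
    by apply: leq_sum => x _; case: ifP => // /xsm ->.
  apply: leq_trans (leq_mul (leqnn (2 ^ k.+1)) le1).
  rewrite big_distrr /= big_seq [X in _ < X]big_seq.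
  case: xs hi xs0 {uxs xsm xsk sxs xsS lo le1} => // x xs hi _.
  rewrite -!big_seq !big_cons -addSn mul1n; apply: leq_add.
    by apply: hi; rewrite mem_head.
  rewrite big_seq [X in _ <= X]big_seq; apply: leq_sum => y yx.
  by rewrite ?mul1n ltnW // hi // inE yx orbT.
(* Fewer than 2^(k-q) slots has probability at most 2^(k-q) p_x <= 2^-q, and blocks are narrower
   than this by the factor 2^(q+1). *)
apply: (@balanced_pair _ _ q (2 ^ (3 * q + 2)) S xs
  (2 ^ (k - (2 * q + 1))) (2 ^ (k - q))) => //.
- by rewrite expn_gt0.
- by rewrite -expnD leq_exp2l //; lia.
- move=> x xx; have := count_fib_lt (2 ^ (k - q)) (xsS x xx).
  rewrite -(leq_pmul2l (_ : 0 < 2 ^ q)) ?expn_gt0 // mulnA -expnD => h.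
  by apply: leq_trans h _; rewrite subnKC ?lo //; lia.
- move=> x xx; rewrite -expnD; set m := _ + _.
  have := count_index_min (2 ^ m) (xsm x xx).
  move: (count _ _) (hi x xx) (nlin_gt0 (S :\ x)) => c hx e0 h.
  have mE : m = q + k.+1 by rewrite /m; lia.
  rewrite mE expnD in h.
  have p0 : 0 < 2 ^ k.+1 * nlin (S :\ x) by rewrite muln_gt0 expn_gt0.
  rewrite -(leq_pmul2l p0).
  apply: (@leq_trans (nlin S ^ 2)); first by apply: leq_trans h; lia.
  by rewrite -mulnn leq_mul2r (ltnW hx) orbT.
Qed.

Lemma min_clump_gt0 q : 0 < min_clump q.
Proof. by rewrite expn_gt0. Qed.

Lemma scale_class_balanced q S k :
  min_clump q <= #|[set x in min_of S | scale S x == k]| ->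
  exists x y, balanced q S x y.
Proof.
rewrite cardE; apply: (@scale_balanced q S k) => [|x|x]; first exact: enum_uniq.
  by rewrite mem_enum inE => /andP[].
by rewrite mem_enum inE => /andP[_ /eqP].
Qed.

Lemma scale_le S x : x \in S -> scale S x <= trunc_log 2 #|S|.
Proof.
move=> xS; apply: leq_trunc_log.
by rewrite -(mulnK #|S| (nlin_gt0 (S :\ x))) leq_div2r ?nlin_le_del.
Qed.

Lemma sum_scale S (F : nat -> nat) m : {in min_of S, forall x, scale S x <= m} ->
  \sum_(x in min_of S) F (scale S x) =
  \sum_(k < m.+1) #|[set x in min_of S | scale S x == k]| * F k.
Proof.
move=> le_m.
rewrite (partition_big (fun x => inord (scale S x) : 'I_m.+1) predT) //=.
apply: eq_bigr => k _; rewrite -sum1_card big_distrl /=.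
apply: eq_big => x.
  rewrite [RHS]inE; case xm: (x \in min_of S) => //=.
  by rewrite -val_eqE /= inordK // ltnS le_m.
by case/andP=> xm /eqP <-; rewrite inordK ?ltnS ?le_m ?mul1n.
Qed.

(** Pigeonhole over the log2 |S| + 1 possible scales. *)
Lemma many_minimal_balanced q S :
  min_clump q * (trunc_log 2 #|S|).+1 <= #|min_of S| ->
  exists x y, balanced q S x y.
Proof.
set L := trunc_log 2 #|S| => big_min.
have [/existsP[k /scale_class_balanced //]|/existsPn small] :=
  boolP [exists k : 'I_L.+1,
           min_clump q <= #|[set x in min_of S | scale S x == k]|].
have le_L : {in min_of S, forall x, scale S x <= L}.
  by move=> x /(subsetP (min_of_sub S)) /scale_le.
have := sum_scale (fun=> 1) le_L; rewrite sum1_card => cE.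
suff: #|min_of S| < min_clump q * L.+1 by rewrite ltnNge big_min.
have -> : min_clump q * L.+1 = \sum_(k < L.+1) min_clump q.
  by rewrite sum_nat_const card_ord mulnC.
rewrite cE !big_ord_recl /= -addSn.
have lt_k (k : 'I_L.+1) :
    #|[set x in min_of S | scale S x == k]| * 1 < min_clump q.
  by rewrite muln1 ltnNge small.
by apply: leq_add (lt_k ord0) _; apply: leq_sum => k _; exact: ltnW (lt_k (lift ord0 k)).
Qed.

Lemma sum_pow2 m k : k <= m ->
  \sum_(i < m.+1 | k <= i) 2 ^ (m - i) < 2 ^ (m - k).+1.
Proof.
elim: m => [|m IH] in k *; rewrite leq_eqVlt => /predU1P[->|km].
- by rewrite big_mkcond big_ord1.
- by [].
- rewrite big_mkcond big_ord_recr /= leqnn subnn addn1 big1 // => i _.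
  by rewrite leqNgt ltn_ord.
rewrite big_mkcond big_ord_recr /= (leqW (km : k <= m)) subnn expn0.
have -> : \sum_(i < m.+1) (if k <= i then 2 ^ (m.+1 - i) else 0)
    = 2 * \sum_(i < m.+1 | k <= i) 2 ^ (m - i).
  rewrite big_distrr /= [RHS]big_mkcond; apply: eq_bigr => i _.
  by case: ifP => // _; rewrite -expnS subSn // -ltnS.
have := IH k km; rewrite (subSn (km : k <= m)) (expnS 2 (m - k).+1).
lia.
Qed.

(* Since [sum_x nlin (S :\ x) = nlin S], few elements in each dyadic class    *)
(* would force the sum to be a small geometric series.                        *)
Lemma high_minimal_balanced q S k : S != set0 ->
  {in min_of S, forall x, 2 ^ k * nlin (S :\ x) <= nlin S} ->
  2 * min_clump q <= 2 ^ k -> exists x y, balanced q S x y.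
Proof.
move=> S0 high big_k; set L := trunc_log 2 #|S|.
have [/existsP[j /scale_class_balanced //]|/existsPn small] :=
  boolP [exists j : 'I_L.+1,
           min_clump q <= #|[set x in min_of S | scale S x == j]|].
have mS x : x \in min_of S -> x \in S := subsetP (min_of_sub S) x.
have le_L : {in min_of S, forall x, scale S x <= L} by move=> x /mS /scale_le.
have ge_k : {in min_of S, forall x, k <= scale S x}.
  move=> x xm; have /andP[_ hx] := scaleP (mS x xm).
  have := leq_ltn_trans (high x xm) hx.
  by rewrite ltn_pmul2r ?nlin_gt0 // ltn_exp2l.
exfalso; have [x0 x0m] := min_of_neq0 S0.
have kL : k <= L by apply: leq_trans (ge_k _ x0m) (le_L _ x0m).
have le1 : 2 ^ L <= \sum_(x in min_of S) 2 ^ (L - scale S x).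
  rewrite -(leq_pmul2r (nlin_gt0 S)) {1}nlin_rec // big_distrr big_distrl /=.
  apply: leq_sum => x xm; have /andP[hx _] := scaleP (mS x xm).
  rewrite -{1}(subnK (le_L x xm)) expnD -mulnA.
  by rewrite leq_mul2l hx orbT.
have := sum_scale (fun j => 2 ^ (L - j)) le_L.
set X := \sum_(x in _) _ in le1 *; move=> XE.
have le2 : X <= min_clump q * \sum_(j < L.+1 | k <= j) 2 ^ (L - j).
  rewrite XE big_distrr [X in _ <= X]big_mkcond /=; apply: leq_sum => j _.
  case: ifP => kj; first by rewrite leq_mul2r ltnW ?orbT // ltnNge small.
  rewrite (_ : [set x in min_of S | scale S x == j] = set0) ?cards0 //.
  apply/setP => x; rewrite [LHS]inE in_set0; apply/negbTE/negP => /andP[xm /eqP e].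
  by have := ge_k x xm; rewrite e kj.
have lt3 := sum_pow2 kL.
have : 2 ^ L < min_clump q * 2 ^ (L - k).+1.
  apply: leq_ltn_trans le1 _; apply: leq_ltn_trans le2 _.
  by rewrite ltn_pmul2l // min_clump_gt0.
rewrite -{1}(subnK kL) expnD expnS mulnCA (mulnC (2 ^ (L - k))) mulnA.
by rewrite ltn_pmul2r ?expn_gt0 // ltnNge big_k.
Qed.

End Minimal.

(** * Large antichains: counting extensions to find many slots *)

Section Antichain.
Context {d : Order.disp_t} {P : finPOrderType d}.
Implicit Types (S A B : {set P}) (x y z : P) (s g h t : seq P).

Lemma antichainP A :
  reflect {in A &, forall x y, ~~ (x < y)%O} (antichain A).
Proof.
apply: (iffP forall_inP) => [h x y xA yA|h x xA].
  have /forall_inP/(_ y yA)/implyP := h x xA.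
  case: eqVneq => [->|_ /(_ isT)]; first by rewrite ltxx.
  by apply: contraNN => /ltW; rewrite /Order.comparable => ->.
apply/forall_inP => y yA; apply/implyP => xy.
rewrite /Order.comparable !le_eqVlt (negPf xy) eq_sym (negPf xy) /=.
by rewrite (negPf (h x y xA yA)) (negPf (h y x yA xA)).
Qed.

(** An extension is a shuffle of its restrictions to [B] and to the complement, and a shuffle is one
    of 2^|S| choices. The induction spends one factor 2 on the side of the first element. *)
Lemma nlin_split_le S B :
  nlin S <= 2 ^ #|S| * (nlin (S :&: B) * nlin (S :\: B)).
Proof.
elim: {S}_.+1 {-2}S (ltnSn #|S|) => // n IH S Sn.
have [->|S0] := eqVneq S set0.
  by rewrite set0I set0D cards0 mul1n leq_pmulr // nlin_gt0.
have sum_min_le (T : {set P}) : \sum_(z in min_of T) nlin (T :\ z) <= nlin T.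
  have [->|T0] := eqVneq T set0; last by rewrite -nlin_rec.
  by rewrite big1 // => z /(subsetP (min_of_sub _)); rewrite inE.
rewrite nlin_rec // (bigID (fun z => z \in B)) /=.
have cS : #|S| = #|S|.-1.+1 by rewrite prednK // card_gt0.
have step z : z \in min_of S -> nlin (S :\ z) <=
    2 ^ #|S|.-1 * (nlin ((S :\ z) :&: B) * nlin ((S :\ z) :\: B)).
  move=> /(subsetP (min_of_sub _)) zS; have := cardsD1 z S.
  rewrite zS add1n => c1; rewrite -[#|S|.-1]/(#|S|.-1) c1 /=.
  by apply: IH; rewrite -ltnS -c1.
have min_subset (T : {set P}) z : T \subset S -> z \in min_of S -> z \in T -> z \in min_of T.
  move=> TS /min_ofP[_ hz] zT; apply/min_ofP; split=> // y yT.
  by apply: hz; apply: (subsetP TS).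
rewrite {1}cS expnS mul2n -addnn mulnDl; apply: leq_add.
  apply: (@leq_trans (2 ^ #|S|.-1 *
     ((\sum_(z in min_of (S :&: B)) nlin ((S :&: B) :\ z)) * nlin (S :\: B)))).
    rewrite big_distrl big_distrr /= big_mkcond [X in _ <= X]big_mkcond /=.
    apply: leq_sum => z _; case: ifP => // /andP[zm zB].
    have zS := subsetP (min_of_sub _) _ zm.
    have -> : z \in min_of (S :&: B).
      by apply: min_subset zm _; rewrite ?subsetIl // inE zS.
    apply: leq_trans (step z zm) _.
    have -> : (S :\ z) :&: B = (S :&: B) :\ z.
      by apply/setP => y; rewrite !inE andbA.
    have -> // : (S :\ z) :\: B = S :\: B.
    apply/setP => y; rewrite !inE; case: eqVneq => // ->.
    by rewrite zB.
  by rewrite leq_mul2l leq_mul2r sum_min_le !orbT.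
apply: (@leq_trans (2 ^ #|S|.-1 *
   (nlin (S :&: B) * (\sum_(z in min_of (S :\: B)) nlin ((S :\: B) :\ z))))).
  rewrite !big_distrr /= big_mkcond [X in _ <= X]big_mkcond /=.
  apply: leq_sum => z _; case: ifP => // /andP[zm zB].
  have zS := subsetP (min_of_sub _) _ zm.
  have -> : z \in min_of (S :\: B).
    by apply: min_subset zm _; rewrite ?subsetDl // inE zB.
  apply: leq_trans (step z zm) _.
  have -> : (S :\ z) :\: B = (S :\: B) :\ z.
    by apply/setP => y; rewrite !inE andbCA.
  have -> // : (S :\ z) :&: B = S :&: B.
  apply/setP => y; rewrite !inE; case: eqVneq => // ->.
  by rewrite (negPf zB) !andbF.
by rewrite leq_mul2l leq_mul2l sum_min_le !orbT.
Qed.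

Lemma nlin_cat_ge S A B : S = A :|: B -> [disjoint A & B] ->
  {in A & B, forall x y, ~~ (y < x)%O} -> nlin A * nlin B <= nlin S.
Proof.
move=> -> dAB hAB.
rewrite /nlin -(size_allpairs cat); apply: uniq_leq_size.
  apply: allpairs_uniq; try exact: lin_uniq.
  move=> [s t] [s' t'] /allpairsP[[a b] [/= al _ [-> ->]]].
  move=> /allpairsP[[a' b'] [/= al' _ [-> ->]]] /eqP.
  by rewrite eqseq_cat ?(size_lin al) ?(size_lin al') // => /andP[/eqP-> /eqP->].
move=> s /allpairsP[[a b] [/= /linP[ua aE pa] /linP[ub bE pb] ->]].
apply/linP; split.
- rewrite cat_uniq ua ub andbT /=; apply/hasPn => y; rewrite bE => yB.
  rewrite /= aE; apply/negP => yA.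
  by move/pred0P: dAB => /(_ y); rewrite /= yA yB.
- by move=> y; rewrite mem_cat aE bE inE.
- rewrite pairwise_cat pa pb !andbT; apply/allrelP => x y; rewrite aE bE.
  exact: hAB.
Qed.

Lemma nlin_antichain A : antichain A -> nlin A = #|A|`!.
Proof.
move=> /antichainP hA; rewrite /nlin /lin (eq_in_filter (a2 := predT)).
  by rewrite filter_predT size_permutations ?enum_uniq // -cardE.
move=> s; rewrite mem_permutations => sE.
have {sE} : {subset s <= A} by move=> y; rewrite (perm_mem sE) mem_enum.
elim: s => //= x s IH sA; rewrite IH ?andbT => [|y ys]; last first.
  by apply: sA; rewrite inE ys orbT.
apply/allP => y ys; apply: hA; apply: sA; by rewrite inE ?eqxx // ys orbT.
Qed.

(** Split the complement of [A] into what lies strictly below some element of [A] and the rest.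
    Listing the lower part, then [A] in any order, then the rest, extends [S]; the factor 2^|S| pays
    for the split. *)
Lemma nlin_del_antichain S A : A \subset S -> antichain A ->
  nlin (S :\: A) * #|A|`! <= 2 ^ #|S| * nlin S.
Proof.
move=> AS Aac; have hA := antichainP _ Aac.
pose B := [set z | [exists x in A, (z < x)%O]].
set T := S :\: A.
have le1 := nlin_split_le T B.
have dAB : [disjoint T :&: B & A].
  by apply/pred0P => y /=; rewrite !inE; case: (y \in A); rewrite ?andbF.
have le2 : nlin (T :&: B) * #|A|`! <= nlin ((T :&: B) :|: A).
  rewrite -nlin_antichain //; apply: nlin_cat_ge => // x y.
  rewrite !inE => /andP[_ /existsP[z /andP[zA xz]]] yA.
  by apply/negP => yx; have := hA y z yA zA; rewrite (lt_trans yx xz).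
have le3 : nlin ((T :&: B) :|: A) * nlin (T :\: B) <= nlin S.
  apply: nlin_cat_ge.
  - apply/setP => y; rewrite !(in_setU, in_setI, in_setD); have := subsetP AS y.
    by case: (y \in A) => [->//|_]; case: (y \in S); case: (y \in B).
  - apply/pred0P => y /=; rewrite !(in_setU, in_setI, in_setD); have := subsetP AS y.
    by case: (y \in A) => [->//|_]; case: (y \in S); case: (y \in B).
  - move=> x y; rewrite !inE => xTA /andP[yB /andP[_ yS]].
    apply: contra yB => yx; case/orP: xTA => [/andP[_]|xA].
      move=> /existsP[z /andP[zA xz]]; apply/existsP; exists z.
      by rewrite zA (lt_trans yx xz).
    by apply/existsP; exists x; rewrite xA.
have le4 : 2 ^ #|T| <= 2 ^ #|S|.
  by rewrite leq_exp2l // subset_leq_card // subsetDl.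
apply: (@leq_trans (2 ^ #|T| * (nlin (T :&: B) * nlin (T :\: B)) * #|A|`!)).
  by rewrite leq_mul2r le1 orbT.
rewrite -!mulnA; apply: leq_mul le4 _; rewrite mulnCA mulnC.
apply: leq_trans le3; rewrite -mulnA (mulnC (_`!)) mulnA.
by rewrite mulnAC leq_mul2r le2 orbT.
Qed.

(** Since [x0] puts no constraint on [x], every slot of [x] in the absence of [x0] survives its
    reinsertion: the map [del x0] from the larger fibre covers the smaller one. *)
Lemma fib_del S x x0 s : s \in lin S -> x \in S -> x0 \in S -> x != x0 ->
  ~~ (x < x0)%O -> ~~ (x0 < x)%O ->
  fib (S :\ x0) x (del x (del x0 s)) <= fib S x (del x s).
Proof.
move=> sl xS x0S xx0 n1 n2.
set h := del x s; have hl : h \in lin (S :\ x) by exact: del_lin.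
have x0Sx : x0 \in S :\ x by rewrite !inE eq_sym xx0.
have xSx0 : x \in S :\ x0 by rewrite !inE xx0.
have -> : del x (del x0 s) = del x0 h.
  by rewrite /h /del -!filter_predI; apply: eq_filter => y /=; rewrite andbC.
rewrite /fib -!size_filter -[X in _ <= X](size_map (del x0)).
apply: uniq_leq_size; first exact/filter_uniq/lin_uniq.
move=> t; rewrite mem_filter => /andP[/eqP th tl].
have [h1 [h2 [hE h1x h2x delh]]] := lin_split hl x0Sx.
have [t1 [t2 [tE t1x t2x delt]]] := lin_split tl xSx0.
have gE : h1 ++ h2 = t1 ++ t2 by rewrite -delh -delt th.
have := tl; rewrite tE lin_insE // => /and3P[gl a1 a2].
have xh : x \notin h by have [_ -> _] := linP _ _ hl; rewrite !inE eqxx.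
have x0t : x0 \notin t by have [_ -> _] := linP _ _ tl; rewrite !inE eqxx.
apply/mapP.
(* The place of [x] in [t] is compared with that of [x0] in [h], to decide which comes first in the
   common extension. *)
have [le|gt] := leqP (size t1) (size h1).
  have h1E : h1 = t1 ++ drop (size t1) h1.
    rewrite -{1}(cat_take_drop (size t1) h1); congr (_ ++ _).
    have := congr1 (take (size t1)) gE; rewrite take_cat take_size_cat //.
    by case: ltngtP le => // -> _; rewrite subnn take0 cats0 take_size.
  set m := drop _ _ in h1E.
  have t2E : t2 = m ++ h2.
    by move/eqP: gE; rewrite h1E -catA eqseq_cat // eqxx => /eqP.
  have mem1 : {subset t1 <= h} by move=> y yt; rewrite hE h1E !mem_cat yt.
  exists (t1 ++ x :: (m ++ x0 :: h2)).
    rewrite mem_filter del_cat.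
    - rewrite hE h1E -catA eqxx lin_insE // a1 /= catA -h1E -hE hl.
      by move: a2; rewrite t2E !all_cat /= n2 => /andP[-> ->].
    - by apply: contra xh => /mem1.
    - by apply: contra xh => xin; rewrite hE h1E -catA mem_cat xin orbT.
  rewrite -cat_cons catA del_cat.
  - by rewrite t2E -catA.
  - rewrite mem_cat inE negb_or eq_sym (negPf xx0) /=.
    by move: h1x; rewrite h1E mem_cat negb_or => /andP[-> ->].
  - exact: h2x.
have t1E : t1 = h1 ++ drop (size h1) t1.
  rewrite -{1}(cat_take_drop (size h1) t1); congr (_ ++ _).
  by have := congr1 (take (size h1)) gE; rewrite take_size_cat // take_cat gt.
set m := drop _ _ in t1E.
have h2E : h2 = m ++ t2.
  by move/eqP: gE; rewrite t1E -catA eqseq_cat // eqxx => /eqP.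
exists ((h1 ++ x0 :: m) ++ x :: t2).
  rewrite mem_filter del_cat.
  - rewrite hE h2E -catA eqxx lin_insE // a2 -catA cat_cons -h2E -hE hl /= andbT.
    by move: a1; rewrite t1E !all_cat /= n1.
  - by apply: contra xh => xin; rewrite hE h2E -cat_cons catA mem_cat xin.
  - by apply: contra xh => xin; rewrite hE h2E -cat_cons catA mem_cat xin orbT.
rewrite -catA cat_cons del_cat //; first by rewrite t1E -catA.
by apply: contra x0t => xin; rewrite tE t1E -catA mem_cat xin orbT.
Qed.

(** Peel off [x0]: over one of its fibres the weights 1/[fib] add up to 1, and by [fib_del] the
    other factors do not decrease when [x0] is deleted. *)
Lemma sum_prod_fib S xs : uniq xs -> {subset xs <= S} ->
  {in xs &, forall x y, ~~ (x < y)%O} ->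
  (\sum_(s <- lin S) \prod_(x <- xs) (fib S x (del x s))%:R^-1
    <= (nlin (S :\: [set x in xs]))%:R :> rat)%R.
Proof.
elim: xs S => [|x0 xs IH] S /=.
  move=> _ _ _; under eq_bigr do rewrite big_nil.
  rewrite (_ : [set _ in _] = set0) ?setD0; last by apply/setP => y; rewrite !inE.
  by rewrite nlin_sum natr_sum.
case/andP=> x0xs uxs xsS inc.
have x0S : x0 \in S by apply: xsS; rewrite mem_head.
have xsSx : {subset xs <= S :\ x0}.
  move=> x xx; rewrite !inE xsS ?inE ?xx ?orbT // andbT.
  by apply: contra x0xs => /eqP <-.
have inc' : {in xs &, forall x y, ~~ (x < y)%O}.
  by move=> x y xx yy; apply: inc; rewrite inE ?xx ?yy orbT.
rewrite (_ : S :\: [set x in x0 :: xs] = (S :\ x0) :\: [set x in xs]); last first.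
  by apply/setP => y; rewrite !inE negb_or andbA [X in X && _]andbC.
apply: le_trans (IH _ uxs xsSx inc').
rewrite (big_lin_del _ _ _ x0S) /= big_seq [leRHS]big_seq.
apply: ler_sum => g gl.
set p := (\prod_(x <- xs) _)%R.
have le1 s : s \in lin S -> del x0 s = g ->
   (\prod_(x <- x0 :: xs) (fib S x (del x s))%:R^-1 <= (fib S x0 g)%:R^-1 * p)%R.
  move=> sl sg; rewrite big_cons sg; apply: ler_wpM2l; first by rewrite invr_ge0.
  rewrite /p big_seq [leRHS]big_seq; apply: ler_prod => x xx.
  have xS : x \in S by apply: xsS; rewrite inE xx orbT.
  have := xsSx x xx; rewrite !inE => /andP[xx0 _].
  rewrite invr_ge0 ler0n /= lef_pV2 ?posrE ?ltr0n ?fib_gt0 ?del_lin //.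
  - by rewrite -sg ler_nat fib_del // inc // !inE ?eqxx ?xx ?orbT.
  - exact: xsSx.
  - exact: xsSx.
apply: (@le_trans _ _ (\sum_(s <- lin S | del x0 s == g) (fib S x0 g)%:R^-1 * p))%R.
  rewrite big_seq_cond [leRHS]big_seq_cond /=.
  by apply: ler_sum => s /andP[sl /eqP sg]; exact: le1.
rewrite big_const_seq iter_addr_0 -[leLHS]mulr_natl mulrA.
by rewrite -/(fib S x0 g) divff ?mul1r // pnatr_eq0 -lt0n fib_gt0.
Qed.

(** Through (n+a)^_a = C(n+a, a) a! and C(n+a, a) <= 2^(n+a). *)
Lemma expn_le_bin n a : a <= n -> n ^ a <= 4 ^ n * a`!.
Proof.
move=> an; apply: (@leq_trans ((n + a) ^_ a)).
  elim: a {an} n => // a IH n; rewrite addnS ffactSS expnS.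
  by apply: leq_mul (IH n); lia.
rewrite -bin_ffact leq_mul2r; apply/orP; right.
apply: (@leq_trans (2 ^ (n + a))); last first.
  by rewrite -[4]/(2 ^ 2) -expnM leq_exp2l //; lia.
rewrite -{1}[2]/(1 + 1) expnDn.
have la : a < (n + a).+1 by lia.
by rewrite (bigD1 (Ordinal la)) //= !exp1n !muln1 leq_addr.
Qed.

(* [E prod_x 1 / fib_x <= 2^n / a!] leaves room for only [O(n / q)] elements  *)
(* of the antichain, on average, with at most [n / 2^q] slots.                *)
Lemma sum_count_fib q S A : A \subset S -> antichain A ->
  q * \sum_(x in A) count (fun s => fib S x (del x s) * 2 ^ q <= #|S|) (lin S)
    <= (3 * #|S| + 1) * nlin S.
Proof.
move=> AS Aac; set n := #|S|; set a := #|A|.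
have an : a <= n by exact: subset_leq_card.
pose bad x s := fib S x (del x s) * 2 ^ q <= n.
pose Bd s := \sum_(x in A) bad x s : nat.
have sumE : \sum_(x in A) count (bad x) (lin S) = \sum_(s <- lin S) Bd s.
  rewrite exchange_big /=; apply: eq_bigr => x _.
  by rewrite -sum1_count big_mkcond /=; apply: eq_bigr => s _; case: ifP.
(* Multiply [sum_prod_fib] by n^a: each factor n/[fib] is at least 1, and at least 2^q for a bad
   element. *)
have key : \sum_(s <- lin S) 2 ^ (q * Bd s) <= 8 ^ n * nlin S.
  have xsS : {subset enum A <= S} by move=> x; rewrite mem_enum => /(subsetP AS).
  have inc : {in enum A &, forall x y, ~~ (x < y)%O}.
    by move=> x y; rewrite !mem_enum; exact: (antichainP _ Aac).
  have := sum_prod_fib (enum_uniq A) xsS inc.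
  rewrite (_ : [set x in enum A] = A); last by apply/setP => y; rewrite inE mem_enum.
  move=> le1.
  have le2 : (\sum_(s <- lin S) (2 ^ (q * Bd s))%:R
      <= (n ^ a)%:R * (nlin (S :\: A))%:R :> rat)%R.
    have [n0|n0] := posnP n.
      have A0 : A = set0 by apply/eqP; rewrite -cards_eq0 -leqn0 -/a -n0.
      have a0 : a = 0 by rewrite /a A0 cards0.
      rewrite n0 a0 expn0 mul1r A0 setD0 nlin_sum natr_sum; apply: ler_sum => s _.
      by rewrite /Bd A0 big_set0 muln0.
    apply: le_trans (ler_wpM2l _ le1); last by rewrite ler0n.
    rewrite mulr_sumr big_seq [leRHS]big_seq; apply: ler_sum => s sl.
    have -> : ((n ^ a)%:R = \prod_(x <- enum A) n%:R :> rat)%R.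
      by rewrite big_const_seq count_predT natrX -cardE /GRing.exp -Monoid.iteropE.
    have -> : ((2 ^ (q * Bd s))%:R =
        \prod_(x <- enum A) (2 ^ (q * bad x s))%:R :> rat)%R.
      rewrite big_enum /= /Bd big_distrr /= -natr_prod; congr (_%:R)%R.
      exact: expn_sum.
    rewrite -big_split /= big_seq [leRHS]big_seq; apply: ler_prod => x xA.
    have xS := xsS x xA.
    have f0 : 0 < fib S x (del x s) by rewrite fib_gt0 ?del_lin.
    rewrite ler0n /= ler_pdivlMr ?ltr0n // -natrM ler_nat /bad.
    case: (leqP (fib S x (del x s) * 2 ^ q) n) => h; first by rewrite muln1 mulnC.
    by rewrite muln0 mul1n fib_le.
  rewrite -natr_sum -natrM ler_nat in le2.
  have le3 := nlin_del_antichain AS Aac.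
  have le4 := expn_le_bin an.
  have f0 : 0 < a`! by exact: fact_gt0.
  rewrite -(leq_pmul2r f0); apply: leq_trans (leq_mul le2 (leqnn _)) _.
  rewrite -mulnA; apply: leq_trans (leq_mul le4 le3) _.
  have -> : 8 ^ n = 4 ^ n * 2 ^ n by rewrite -expnMn.
  rewrite -/n; lia.
rewrite sumE.
have p0 : 0 < 8 ^ n by rewrite expn_gt0.
rewrite -(leq_pmul2l p0) big_distrr big_distrr /=.
(* From exponential moment to mean: 8^n z <= 8^n (3n) + 2^z for every z. *)
apply: (@leq_trans (\sum_(s <- lin S) (8 ^ n * (3 * n) + 2 ^ (q * Bd s)))).
  apply: leq_sum => s _; move: (q * Bd s) => z.
  have [zn|zn] := leqP z (3 * n).
    by apply: leq_trans (leq_addr _ _); rewrite leq_mul2l zn orbT.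
  have -> : 2 ^ z = 8 ^ n * 2 ^ (z - 3 * n).
    by rewrite -[8]/(2 ^ 3) -expnM -expnD subnKC // ltnW.
  rewrite -mulnDr leq_mul2l; apply/orP; right.
  have := ltn_expl (z - 3 * n) (isT : 1 < 2); lia.
rewrite big_split /= big_const_seq count_predT iter_addn_0 -/(nlin S).
lia.
Qed.

Definition wide_exponent q c : nat := 8 * c * 2 ^ q.
(** The first summand makes log2 n at least r + q + 1, so that the block width is a power of 2; the
    second makes half of the antichain a clump. *)
Definition wide_threshold q c : nat :=
  2 ^ (wide_exponent q c + q + 1) +
  2 * c * clump q (2 ^ (wide_exponent q c + q + 2)).

Lemma wide_balanced q c S A : A \subset S -> antichain A ->
  #|S| <= c * #|A| -> wide_threshold q c <= #|S| ->
  exists x y, balanced q S x y.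
Proof.
move=> AS Aac ca; rewrite /wide_threshold; set r := wide_exponent q c.
set K := 2 ^ (r + q + 2) => big_n.
set n := #|S| in ca big_n; set a := #|A| in ca.
have n0 : 0 < n by apply: leq_trans big_n; rewrite addn_gt0 expn_gt0.
have c0 : 0 < c by case: c ca @r @K big_n => // /(leq_trans n0).
set k := trunc_log 2 n.
have /andP[kn nk] := trunc_log_bounds (isT : 1 < 2) n0.
rewrite -/k in kn nk.
have kr : r + q + 1 <= k.
  rewrite -ltnS -(ltn_exp2l _ _ (isT : 1 < 2)); apply: leq_ltn_trans nk.
  by apply: leq_trans big_n; rewrite leq_addr.
pose cnt x := count (fun s => fib S x (del x s) * 2 ^ r <= n) (lin S).
pose G := [set x in A | 2 ^ q * cnt x <= nlin S].
(* Markov over [A]: each element outside [G] has few slots with probability above 2^-q, and r = 8 c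
   2^q is chosen so that at most half of [A] can do so. *)
have bigG : a <= 2 * #|G|.
  have le1 : r * \sum_(x in A) cnt x <= (3 * n + 1) * nlin S.
    exact: sum_count_fib.
  have le2 : #|A :\: G| * nlin S <= 2 ^ q * \sum_(x in A) cnt x.
    rewrite -sum1_card big_distrl big_distrr /= big_mkcond [X in _ <= X]big_mkcond /=.
    apply: leq_sum => x _; rewrite !inE; case: (x \in A) => //=; rewrite ?andbF //.
    by rewrite andbT; case: (leqP (2 ^ q * cnt x) (nlin S)) => // h; rewrite mul1n ltnW.
  have cG : a = #|G| + #|A :\: G|.
    rewrite /a -(cardsID G A) (setIidPr _) //.
    by apply/subsetP => x; rewrite inE => /andP[].
  have e0 := nlin_gt0 S.
  have le3 : r * (#|A :\: G| * nlin S) <= 2 ^ q * ((3 * n + 1) * nlin S).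
    apply: leq_trans (leq_mul (leqnn r) le2) _; rewrite mulnCA leq_mul2l le1.
    by rewrite orbT.
  have {le1 le2}le4 : r * #|A :\: G| <= 2 ^ q * (3 * n + 1).
    by move: le3; rewrite !mulnA leq_pmul2r.
  have pq : 0 < c * 2 ^ q by rewrite muln_gt0 c0 expn_gt0.
  have : 8 * #|A :\: G| <= 4 * a.
    rewrite -(leq_pmul2l pq).
    apply: (@leq_trans (2 ^ q * (3 * n + 1))).
      by apply: leq_trans le4; rewrite /r /wide_exponent; lia.
    apply: (@leq_trans (2 ^ q * (4 * (c * a)))); last by lia.
    by rewrite leq_mul2l; apply/orP; right; lia.
  by rewrite cG; lia.
apply: (@balanced_pair _ _ q K S (enum G) (2 ^ (k - (r + q + 1))) (2 ^ (k - r))).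
- exact: enum_uniq.
- by move=> x; rewrite mem_enum inE => /andP[/(subsetP AS)].
- rewrite -cardE -(leq_pmul2l (isT : 0 < 2)).
  apply: leq_trans bigG; rewrite -(leq_pmul2l c0); apply: leq_trans ca.
  apply: leq_trans big_n; rewrite mulnA [c * 2]mulnC.
  by rewrite leq_addl.
- by rewrite expn_gt0.
- by rewrite -expnD leq_exp2l //; lia.
- move=> x; rewrite mem_enum inE => /andP[_]; apply: leq_trans.
  rewrite leq_mul2l; apply/orP; right; apply: sub_count => s /= h.
  apply: leq_trans kn; rewrite -[X in _ <= 2 ^ X](subnK (_ : r <= k)); last by lia.
  by rewrite expnD leq_mul2r ltnW ?orbT.
(* The blocks cover 2^(k+1) > n places, so there is no overflow. *)
- move=> x; rewrite mem_enum inE => /andP[/(subsetP AS) xS _].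
  rewrite (@eq_in_count _ _ pred0) ?count_pred0 ?muln0 // => s sl /=.
  apply/negbTE; rewrite -ltnNge; apply: leq_trans (index_lin_lt sl xS) _.
  apply: ltnW; apply: leq_trans nk _; rewrite /K -expnD leq_exp2l //; lia.
Qed.

End Antichain.

(** * A chain together with an antichain *)

Lemma index_lt_cat (T : eqType) (x y z : T) (s1 s2 : seq T) : x != z -> y != z ->
  (index x (s1 ++ s2) < index y (s1 ++ s2)) =
  (index x (s1 ++ z :: s2) < index y (s1 ++ z :: s2)).
Proof.
move=> xz yz; rewrite !index_cat /= ![z == _]eq_sym (negPf xz) (negPf yz) /=.
by have := index_mem x s1; have := index_mem y s1;
  case: (x \in s1); case: (y \in s1); lia.
Qed.

Section ChainAntichain.
Context {d : Order.disp_t} {P : finPOrderType d}.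
Implicit Types (S A B C U : {set P}) (x y z : P) (s g h t : seq P).

Lemma index_lt_del S s x y z : s \in lin S -> z \in S -> x != z -> y != z ->
  (index x (del z s) < index y (del z s)) = (index x s < index y s).
Proof.
move=> sl zS xz yz; have [s1 [s2 [-> _ _ ->]]] := lin_split sl zS.
exact: index_lt_cat.
Qed.

Lemma lin_index_lt S s x y : s \in lin S -> x \in S -> y \in S -> (x < y)%O ->
  index x s < index y s.
Proof.
move=> sl xS yS xy; have [us sE /(pairwiseP x) ps] := linP _ _ sl.
rewrite ltnNge leq_eqVlt; apply/negP => /predU1P[e|lt].
  have : y = x by rewrite -(nth_index x (_ : y \in s)) ?sE // e nth_index ?sE.
  by move=> eyx; move: xy; rewrite eyx ltxx.
have := ps (index y s) (index x s); rewrite !inE !index_mem !sE.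
by move=> /(_ yS xS lt); rewrite !nth_index ?sE // /may_precede xy.
Qed.

(** The index of [z] is forced to be the number of elements below it. *)
Lemma fib_comparable S z g : z \in S -> {in S, forall y, (z >=< y)%O} ->
  g \in lin (S :\ z) -> fib S z g = 1.
Proof.
move=> zS cz gl; apply/eqP; rewrite eqn_leq fib_gt0 // andbT.
apply: (@count_fib_le _ _ S z g predT [:: count (fun y => (y < z)%O) g]) => //.
move=> s sl sg _; rewrite inE -sg.
have [s1 [s2 [sE z1 z2 ->]]] := lin_split sl zS.
have [us sS _] := linP _ _ sl.
move: (sl); rewrite sE lin_insE // => /and3P[_ /allP a1 /allP a2].
rewrite index_cat_cons // count_cat -[X in X == _]addn0; apply/eqP.
congr (_ + _).
  apply/esym/eqP; rewrite -all_count; apply/allP => y ys.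
  have yS : y \in S by rewrite -sS sE mem_cat ys.
  have yz : y != z by apply: contra z1 => /eqP <-.
  have := cz y yS; rewrite /Order.comparable !le_eqVlt (negPf yz) eq_sym.
  by rewrite (negPf yz) (negPf (a1 y ys)).
apply/esym/eqP; rewrite -leqn0 leqNgt -has_count; apply/hasPn => y ys.
exact: a2.
Qed.

(** With a single slot for [z], deletion is a bijection of extensions that keeps the order of [x]
    and [y]. *)
Lemma balanced_drop q S x y z : z \in S -> {in S, forall u, (z >=< u)%O} ->
  balanced q (S :\ z) x y -> balanced q S x y.
Proof.
move=> zS cz [xS yS xy]; move: xS yS; rewrite !inE.
move=> /andP[xz xS] /andP[yz yS].
have nE : nlin S = nlin (S :\ z).
  rewrite (nlin_fib zS) nlin_sum big_seq [RHS]big_seq.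
  by apply: eq_bigr => g gl; exact: fib_comparable.
have bE u v : u != z -> v != z -> before S u v = before (S :\ z) u v.
  move=> uz vz; rewrite /before (count_lin_del _ zS) -[RHS]sum1_count [RHS]big_mkcond /=.
  rewrite big_seq [RHS]big_seq; apply: eq_bigr => g gl.
  have <- : count (fun s => (index u g < index v g) && (del z s == g)) (lin S)
      = count (fun s => (index u s < index v s) && (del z s == g)) (lin S).
    apply: eq_in_count => s sl /=; case: eqVneq; rewrite ?andbF // => <-.
    by rewrite (index_lt_del sl).
  case: ifP => _ /=; last by rewrite count_pred0.
  exact: fib_comparable.
by rewrite -nE -!bE // => b1 b2; split.
Qed.

Lemma balanced_restrict q S U x y : U \subset S ->
  {in S :\: U, forall z, {in S, forall u, (z >=< u)%O}} ->
  balanced q U x y -> balanced q S x y.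
Proof.
move: {2}_.+1 (ltnSn #|S :\: U|) => n.
elim: n S => // n IH S; rewrite ltnS => cSU US cz bU.
have [SU0|/set0Pn[z zSU]] := eqVneq (S :\: U) set0.
  have -> // : S = U by apply/eqP; rewrite eqEsubset US -setD_eq0 SU0 eqxx.
have /andP[zU zS] : (z \notin U) && (z \in S) by move: zSU; rewrite inE.
apply: (balanced_drop zS (cz z zSU)); apply: IH => //.
- apply: leq_trans cSU; rewrite (cardsD1 z (S :\: U)) zSU add1n.
  by rewrite !setDDl setUC.
- apply/subsetP => u uU; rewrite !inE (subsetP US) // andbT.
  by apply: contra zU => /eqP <-.
- move=> u; rewrite !inE => /andP[uU /andP[_ uS]] v; rewrite !inE => /andP[_ vS].
  by apply: cz; rewrite // inE uU.
Qed.

Lemma chainP C : reflect {in C &, forall x y, (x >=< y)%O} (chain C).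
Proof.
apply: (iffP forall_inP) => [h x y xC yC|h x xC].
  by have /forall_inP := h x xC; apply.
by apply/forall_inP => y; exact: h.
Qed.

Section Slots.
Variables (S C A : {set P}) (x : P).
Hypotheses (SE : S = C :|: A) (Cch : chain C).
Hypotheses (Aac : antichain A) (xA : x \in A).

Let T := [set c in C | ~~ (x >=< c)%O].

Let xS : x \in S. Proof. by rewrite SE inE xA orbT. Qed.

Let inT c : c \in T -> [/\ c \in S, c \in C, ~~ (x < c)%O, ~~ (c < x)%O & c != x].
Proof.
rewrite inE => /andP[cC nc]; split=> //.
- by rewrite SE inE cC.
- by apply: contra nc => /ltW h; rewrite /Order.comparable h.
- by apply: contra nc => /ltW h; rewrite /Order.comparable h orbT.
- by apply: contra nc => /eqP ->; rewrite comparablexx.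
Qed.

(** [x] fits right after any [c] in [T]: chain elements before [c] are below it, those after are
    above it, so a conflict with [x] would make [x] comparable to [c]. Elements of [A] never
    conflict with [x]. *)
Lemma fib_ge_chain g : g \in lin (S :\ x) -> #|T| <= fib S x g.
Proof.
move=> gl; have [ug gE pg] := linP _ _ gl.
have xg : x \notin g by rewrite gE !inE eqxx.
pose ins c := take (index c g).+1 g ++ x :: drop (index c g).+1 g.
have xt k : x \notin take k g by apply: contra xg; exact: mem_take.
have xd k : x \notin drop k g by apply: contra xg; exact: mem_drop.
have Tg c : c \in T -> c \in g.
  by move=> /inT[cS _ _ _ cx]; rewrite gE !inE cx.
rewrite cardE -(size_map ins) /fib -size_filter; apply: uniq_leq_size.
  rewrite map_inj_in_uniq ?enum_uniq // => c c'.
  rewrite !mem_enum => /Tg cg /Tg c'g /(congr1 (index x)).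
  rewrite !index_cat_cons ?xt // !size_takel ?index_mem // => -[e].
  by rewrite -(nth_index x cg) e nth_index.
move=> t /mapP[c]; rewrite mem_enum => cT ->.
have [cS cC n1 n2 cx] := inT cT; have cg := Tg c cT.
rewrite mem_filter del_cat // cat_take_drop eqxx lin_insE // cat_take_drop gl /=.
have cmp y : y \in g -> y \in C \/ (~~ (x < y)%O /\ ~~ (y < x)%O).
  rewrite gE !inE SE inE => /andP[yx /orP[yC|yA]]; [by left | right].
  by split; apply: (antichainP _ Aac).
have cS' : c \in S :\ x by rewrite !inE cx.
apply/andP; split; apply/allP => y yg.
  have yg' := mem_take yg.
  have [yC|[] //] := cmp y yg'.
  have := (chainP _ Cch) c y cC yC; rewrite /Order.comparable => cy.
  apply/negP => xy; case/orP: cy => cy; last by rewrite (lt_le_trans xy cy) in n1.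
  move: cy; rewrite le_eqVlt => /predU1P[e|cy]; first by rewrite e xy in n1.
  have := lin_index_lt gl cS' (_ : y \in S :\ x) cy; rewrite -gE => /(_ yg').
  by move: yg; rewrite in_take // ltnS leqNgt => /negP.
have yg' := mem_drop yg.
have [yC|[] //] := cmp y yg'.
have := (chainP _ Cch) c y cC yC; rewrite /Order.comparable => cy.
apply/negP => yx; case/orP: cy => cy; first by rewrite (le_lt_trans cy yx) in n2.
move: cy; rewrite le_eqVlt => /predU1P[e|cy]; first by rewrite -e yx in n2.
have := lin_index_lt gl (_ : y \in S :\ x) cS' cy; rewrite -gE => /(_ yg') lt.
have yt : y \in take (index c g).+1 g by rewrite in_take // ltnS ltnW.
move: ug; rewrite -(cat_take_drop (index c g).+1 g) cat_uniq.
by case/and3P=> _ /hasPn /(_ y yg); rewrite /= yt.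
Qed.

(* Once [x] is placed relative to every chain element, its index is pinned    *)
(* down up to the elements of [A] that precede it.                            *)
Lemma count_chain_gap (T1 T2 : {set P}) : T1 \subset T -> T \subset T1 :|: T2 ->
  count (fun s => [forall c in T1, index c s < index x s] &&
                  [forall c in T2, index x s < index c s]) (lin S) * #|T|
    <= #|A| * nlin S.
Proof.
move=> T1T TT12; rewrite (count_lin_del _ xS) (nlin_fib xS).
rewrite big_distrl big_distrr /= big_seq [X in _ <= X]big_seq.
apply: leq_sum => g gl; apply: leq_mul (fib_ge_chain gl).
pose D := [set c in C | (c < x)%O] :|: T1.
have <- : size (iota #|D| #|A|) = #|A| by rewrite size_iota.
apply: count_fib_le => // s sl sg /andP[/forall_inP h1 /forall_inP h2].
have [s1 [s2 [sE xs1 xs2 _]]] := lin_split sl xS.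
have [us sS _] := linP _ _ sl.
have ix : index x s = size s1 by rewrite sE index_cat_cons.
have us1 : uniq s1 by move: us; rewrite sE cat_uniq => /and3P[].
have mem1 y : index y s < index x s -> y \in s1.
  by rewrite ix sE index_cat; case: (y \in s1) => //; rewrite ltnNge leq_addr.
have cs1 : #|[set y in s1]| = size s1.
  by rewrite -(card_uniqP us1); apply: eq_card => y; rewrite inE.
have sub1 : D \subset [set y in s1].
  apply/subsetP => c; rewrite !inE => /orP[/andP[cC cx]|/h1 /mem1 //].
  by apply: mem1; apply: (lin_index_lt sl) => //; rewrite SE inE cC.
have sub2 : [set y in s1] :\: D \subset A :\ x.
  apply/subsetP => y; rewrite !inE negb_or => /andP[/andP[nC nT] ys].
  have yx : y != x by apply: contra xs1 => /eqP <-.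
  have yS : y \in S by rewrite -sS sE mem_cat ys.
  rewrite yx; move: (yS); rewrite SE inE => /orP[yC|//].
  exfalso; move: nC; rewrite yC /= => nyx.
  have iyx : index y s < index x s.
    by rewrite ix sE index_cat ys index_mem.
  have [cmp|ncmp] := boolP (x >=< y)%O.
    move: cmp; rewrite /Order.comparable !le_eqVlt (negPf nyx) eq_sym (negPf yx) /=.
    by rewrite orbF => /(lin_index_lt sl xS yS); rewrite ltnNge ltnW.
  have : y \in T1 :|: T2 by apply: (subsetP TT12); rewrite inE yC.
  by rewrite inE (negPf nT) => /h2; rewrite ltnNge ltnW.
have hD : #|D| + #|[set y in s1] :\: D| = size s1.
  by rewrite -cs1 -[RHS](cardsID D) (setIidPr sub1).
have hA : #|[set y in s1] :\: D| < #|A|.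
  by rewrite (cardsD1 x A) xA ltnS subset_leq_card.
by rewrite mem_iota ix -hD leq_addr ltn_add2l hA.
Qed.

End Slots.

Lemma before_compl S x y : x \in S -> y \in S -> x != y ->
  before S x y + before S y x = nlin S.
Proof.
move=> xS yS xy; rewrite /nlin -(count_predC (fun s => index x s < index y s)).
congr (_ + _); apply: eq_in_count => s sl /=; rewrite -leqNgt.
rewrite [RHS]leq_eqVlt; case: eqP => // e.
have [us sE _] := linP _ _ sl.
by case/eqP: xy; rewrite -(nth_index x (_ : x \in s)) ?sE // -e nth_index ?sE.
Qed.

(** The extrema of [D] are read off from the indices in a reference extension [s0]. *)
Lemma arg_chain C s0 (D : {set P}) : chain C -> s0 \in lin [set: P] ->
  D \subset C -> D != set0 ->
  (exists2 c, c \in D & {in D, forall c', (c <= c')%O}) /\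
  (exists2 c, c \in D & {in D, forall c', (c' <= c)%O}).
Proof.
move=> /chainP Cch sl /subsetP DC /set0Pn[c0 c0D]; split.
  case: (@arg_minnP _ c0 (mem D) (fun c => index c s0)) => // c cD hc.
  exists c => // c' c'D; have := Cch c c' (DC _ cD) (DC _ c'D).
  rewrite /Order.comparable => /orP[//|]; rewrite le_eqVlt => /predU1P[->//|lt].
  by have := hc c' c'D; rewrite /= leqNgt (lin_index_lt sl) ?inE.
case: (@arg_maxnP _ c0 (mem D) (fun c => index c s0)) => // c cD hc.
exists c => // c' c'D; have := Cch c c' (DC _ cD) (DC _ c'D).
rewrite /Order.comparable => /orP[|//]; rewrite le_eqVlt => /predU1P[->//|lt].
by have := hc c' c'D; rewrite /= leqNgt (lin_index_lt sl) ?inE.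
Qed.

(** Cut [T] at probability 1/2 into [T1] (likelier before [x]) and [T2]. By [count_chain_gap], [x]
    falls exactly into the cut with probability at most 2^-(q+2). With c1 the top of [T1] and c2 the
    bottom of [T2], 1/2 <= Pr(x before c2) <= Pr(x before c1) + 2^-(q+2) < 1/2 + 2^-(q+2). *)
Lemma chain_balanced q S C A x : S = C :|: A ->
  chain C -> antichain A -> x \in A ->
  2 ^ q.+2 * #|A| <= #|[set c in C | ~~ (x >=< c)%O]| ->
  exists x y, balanced q S x y.
Proof.
move=> SE Cch Aac xA; set T := [set c in C | _] => bigT.
have xS : x \in S by rewrite SE inE xA orbT.
have TS c : c \in T -> c \in S by rewrite SE !inE => /andP[->].
have Tx c : c \in T -> x != c.
  by rewrite inE => /andP[_]; apply: contra => /eqP ->; rewrite comparablexx.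
have [s0 s0l] : exists s0, s0 \in lin [set: P].
  have := nlin_gt0 [set: P]; rewrite /nlin; case: (lin _) => // s0 l _.
  by exists s0; rewrite mem_head.
have e0 := nlin_gt0 S.
have a0 : 0 < #|A| by apply/card_gt0P; exists x.
have q1 : 0 < 2 ^ q by rewrite expn_gt0.
pose T1 := [set c in T | 2 * before S x c < nlin S].
pose T2 := T :\: T1.
have T1T : T1 \subset T by apply/subsetP => c; rewrite inE => /andP[].
have T2T : T2 \subset T by exact: subsetDl.
have TT : T \subset T1 :|: T2.
  by apply/subsetP => c cT; rewrite in_setU in_setD cT andbT orbN.
have TC : T \subset C by apply/subsetP => c; rewrite inE => /andP[].
have := count_chain_gap SE Cch Aac xA T1T TT.
set gap := count _ _ => gapT.
have {gapT bigT}gap_le : 2 ^ q.+2 * gap <= nlin S.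
  rewrite -(leq_pmul2r a0); apply: (@leq_trans (gap * #|T|)).
    by rewrite mulnAC mulnC leq_mul2l bigT orbT.
  by rewrite [X in _ <= X]mulnC.
have idx_le c c' s : s \in lin S -> c \in S -> c' \in S -> (c <= c')%O ->
    index c s <= index c' s.
  move=> sl cS c'S; rewrite le_eqVlt => /predU1P[->//|lt].
  by rewrite ltnW // (lin_index_lt sl).
have ge1 : T1 = set0 \/ exists2 c, c \in T1 & forall s, s \in lin S ->
    index c s < index x s -> [forall c in T1, index c s < index x s].
  have [->|T10] := eqVneq T1 set0; [by left | right].
  have [_ [c cT hc]] := arg_chain Cch s0l (subset_trans T1T TC) T10.
  exists c => // s sl lt; apply/forall_inP => c' c'T; apply: leq_ltn_trans lt.
  by apply: idx_le => //; [apply: TS; apply: (subsetP T1T) | apply: TS;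
    apply: (subsetP T1T) | exact: hc].
have ge2 : T2 = set0 \/ exists2 c, c \in T2 & forall s, s \in lin S ->
    index x s < index c s -> [forall c in T2, index x s < index c s].
  have [->|T20] := eqVneq T2 set0; [by left | right].
  have [[c cT hc] _] := arg_chain Cch s0l (subset_trans T2T TC) T20.
  exists c => // s sl lt; apply/forall_inP => c' c'T; apply: leq_trans lt _.
  by apply: idx_le => //; [apply: TS; apply: (subsetP T2T) | apply: TS;
    apply: (subsetP T2T) | exact: hc].
have lt_of1 c : c \in T1 -> 2 * before S x c < nlin S by rewrite inE => /andP[].
have ge_of2 c : c \in T2 -> nlin S <= 2 * before S x c.
  by rewrite inE => /andP[]; rewrite inE => + cT; rewrite cT -leqNgt.
have gap_small : 4 * gap <= nlin S.
  by apply: leq_trans gap_le; rewrite leq_mul2r -(addn2 q) expnD mulnC leq_pmulr ?orbT.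
(* If [T1] or [T2] is empty, the gap event has probability at least 1/2, against the bound 1/4. *)
case: ge1 => [T10|[c1 c1T h1]]; case: ge2 => [T20|[c2 c2T h2]].
- exfalso.
  have : gap = nlin S.
    rewrite /nlin -count_predT; apply: eq_in_count => s sl /=.
    by apply/andP; split; apply/forall_inP => c; rewrite ?T10 ?T20 inE.
  lia.
- exfalso; have := ge_of2 _ c2T.
  suff : before S x c2 <= gap by move: gap_small e0; clear; lia.
  rewrite /gap /before -!size_filter; apply: uniq_leq_size.
    exact/filter_uniq/lin_uniq.
  move=> s; rewrite mem_filter => /andP[lt sl]; rewrite mem_filter sl andbT.
  by rewrite h2 // andbT; apply/forall_inP => c; rewrite T10 inE.
- exfalso; have c1S := TS _ (subsetP T1T _ c1T).
  have := before_compl xS c1S (Tx _ (subsetP T1T _ c1T)); have := lt_of1 _ c1T.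
  suff : before S c1 x <= gap by move: gap_small e0; clear; lia.
  rewrite /gap /before -!size_filter; apply: uniq_leq_size.
    exact/filter_uniq/lin_uniq.
  move=> s; rewrite mem_filter => /andP[lt sl]; rewrite mem_filter sl andbT.
  by rewrite h1 //; apply/forall_inP => c; rewrite T20 inE.
have c1S := TS _ (subsetP T1T _ c1T); have xc1 := Tx _ (subsetP T1T _ c1T).
have c2S := TS _ (subsetP T2T _ c2T); have xc2 := Tx _ (subsetP T2T _ c2T).
have lt1 := lt_of1 _ c1T; have ge_2 := ge_of2 _ c2T.
have b1 := before_compl xS c1S xc1; have b2 := before_compl xS c2S xc2.
have b12 : before S x c2 <= before S x c1 + gap.
  rewrite /gap /before -count_predUI -size_filter.
  apply: leq_trans (leq_addr _ _); rewrite -size_filter; apply: uniq_leq_size.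
    exact/filter_uniq/lin_uniq.
  move=> s; rewrite mem_filter => /andP[lt sl]; rewrite mem_filter sl andbT /=.
  case: ltnP => //= le; rewrite h2 // andbT h1 // ltn_neqAle le andbT.
  apply/eqP => e; have [us sE _] := linP _ _ sl.
  by case/eqP: xc1; rewrite -(nth_index x (_ : x \in s)) ?sE // -e nth_index ?sE.
exists x, c2; split=> //.
  have : 2 ^ q * before S x c2 <= 2 ^ q * (before S c2 x + 2 * gap).
    by rewrite leq_mul2l; apply/orP; right; move: b12 b2 lt1; clear; lia.
  by move: gap_le; rewrite -(addn2 q) expnD; clear; lia.
apply: leq_trans (leq_addr _ _); rewrite leq_mul2l; apply/orP; right.
by move: b2 ge_2; clear; lia.
Qed.

(** The relevant chain elements form two parts of at most 2^(q+2) |A| elements each; the 1 accounts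
    for [A] itself. *)
Definition chain_threshold q : nat := wide_threshold q (2 ^ q.+3 + 1).

Lemma chain_antichain_balanced q C A : C :|: A = [set: P] -> [disjoint C & A] ->
  chain C -> antichain A -> chain_threshold q <= #|A| ->
  exists x y, balanced q [set: P] x y.
Proof.
move=> CA dCA Cch Aac bigA.
pose U := [set c in C | [exists x in A, ~~ (x >=< c)%O]].
have UC : U \subset C by apply/subsetP => c; rewrite inE => /andP[].
have dUA : [disjoint U & A] := disjointWl UC dCA.
have Uch : chain U.
  by apply/chainP => x y /(subsetP UC) xC /(subsetP UC); apply: (chainP _ Cch).
have notA c : c \in U -> c \notin A.
  by move=> cU; apply/negP => cA; move/pred0P: dUA => /(_ c); rewrite /= cU cA.
suff [x [y bxy]] : exists x y, balanced q (U :|: A) x y.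
  exists x, y; apply: balanced_restrict bxy; first exact: subsetT.
  move=> z; rewrite !inE !negb_or => /andP[/andP[zU zA] _] u _.
  have zC : z \in C by have := in_setT z; rewrite -CA inE (negPf zA) orbF.
  have := in_setT u; rewrite -CA inE => /orP[uC|uA].
    exact: (chainP _ Cch).
  move: zU; rewrite zC /= => /existsPn /(_ u); rewrite uA /= negbK.
  by rewrite comparable_sym.
pose T x := [set c in U | ~~ (x >=< c)%O].
have [/existsP[x /andP[xA bigT]]|/existsPn smallT] :=
  boolP [exists x in A, 2 ^ q.+2 * #|A| <= #|T x|].
  exact: (chain_balanced erefl Uch Aac xA bigT).
have {}smallT x : x \in A -> #|T x| <= 2 ^ q.+2 * #|A|.
  by move=> xA; have := smallT x; rewrite xA /= -ltnNge => /ltnW.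
have [s0 s0l] : exists s0, s0 \in lin [set: P].
  have := nlin_gt0 [set: P]; rewrite /nlin; case: (lin _) => // s0 l _.
  by exists s0; rewrite mem_head.
have Uex c : c \in U -> exists2 y, y \in A & ~~ (y >=< c)%O.
  by rewrite inE => /andP[_ /existsP[y /andP[]]]; exists y.
(* All chain elements below some point of [A] that are not below all of [A]   *)
(* are incomparable to a single point, and dually for the others.             *)
pose D := [set c in U | [exists x in A, (c < x)%O]].
have DU : D \subset U by apply/subsetP => c; rewrite inE => /andP[].
have cD : #|D| <= 2 ^ q.+2 * #|A|.
  have [->|D0] := eqVneq D set0; first by rewrite cards0.
  have [[c0 c0D hc0] _] := arg_chain Uch s0l DU D0.
  have [y0 y0A ny0] := Uex _ (subsetP DU _ c0D).
  apply: leq_trans (smallT y0 y0A); apply: subset_leq_card; apply/subsetP => c cD.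
  have cU := subsetP DU _ cD.
  rewrite inE cU; apply: contra ny0; rewrite /Order.comparable => /orP[yc|cy].
    exfalso; move: cD; rewrite inE => /andP[_ /existsP[x /andP[xA cx]]].
    by have := antichainP _ Aac y0 x y0A xA; rewrite (le_lt_trans yc cx).
  by rewrite (le_trans (hc0 c cD) cy) orbT.
have cUD : #|U :\: D| <= 2 ^ q.+2 * #|A|.
  have [->|D0] := eqVneq (U :\: D) set0; first by rewrite cards0.
  have [_ [c1 c1D hc1]] := arg_chain Uch s0l (subsetDl U D) D0.
  have [y1 y1A ny1] := Uex _ (subsetP (subsetDl U D) _ c1D).
  apply: leq_trans (smallT y1 y1A); apply: subset_leq_card; apply/subsetP => c cUD.
  have /andP[cnD cU] : (c \notin D) && (c \in U) by move: cUD; rewrite in_setD.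
  rewrite inE cU; apply: contra ny1; rewrite /Order.comparable => /orP[yc|cy].
    by rewrite (le_trans yc (hc1 c cUD)).
  exfalso; move: cnD; rewrite inE cU /= => /existsPn /(_ y1).
  rewrite y1A /= lt_neqAle cy andbT negbK => /eqP e.
  by have := notA c cU; rewrite e y1A.
have cU : #|U :|: A| <= (2 ^ q.+3 + 1) * #|A|.
  apply: leq_trans (leq_card_setU _ _) _.
  have := cardsID D U; rewrite (setIidPr DU) => <-.
  by rewrite (expnS 2 q.+2); lia.
apply: (@wide_balanced _ _ q (2 ^ q.+3 + 1) _ A) => //; first exact: subsetUr.
by apply: leq_trans bigA _; apply: subset_leq_card; exact: subsetUr.
Qed.

End ChainAntichain.

(** * Back to [linext], [height] and [delta] *)

Section Transfer.
Context {d : Order.disp_t} {P : finPOrderType d}.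
Implicit Types (x y z : P) (s : seq P).

Definition ffun_of_seq s : {ffun P -> 'I_#|P|} :=
  [ffun x => insubd (enum_rank x) (index x s)].

Lemma ffun_of_seqE s x : s \in lin [set: P] -> ffun_of_seq s x = index x s :> nat.
Proof.
move=> sl; rewrite ffunE val_insubd.
by have := index_lin_lt sl (in_setT x); rewrite cardsT => ->.
Qed.

Lemma lin_linext : perm_eq (enum (linext P)) [seq ffun_of_seq s | s <- lin [set: P]].
Proof.
apply: uniq_perm; first exact: enum_uniq.
  rewrite map_inj_in_uniq ?lin_uniq // => s t sl tl e.
  have [us sE _] := linP _ _ sl; have [ut tE _] := linP _ _ tl.
  have szE : size s = size t by rewrite (size_lin sl) (size_lin tl).
  case: s sl us sE szE e => [|x s] sl us sE szE e; first by case: t szE {tl ut tE e}.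
  apply: (@eq_from_nth _ x) => // i ilt.
  set y := nth x _ i; have iy : index y (x :: s) = i by rewrite index_uniq.
  by rewrite -iy -(ffun_of_seqE y sl) e (ffun_of_seqE y tl) nth_index // tE inE.
move=> f; rewrite mem_enum; apply/idP/mapP => [|[s sl ->]]; last first.
  have [us sE ps] := linP _ _ sl.
  rewrite inE; apply/and3P; split.
  - apply/injectiveP => x y /(congr1 val) /=; rewrite !ffun_of_seqE // => e.
    by rewrite -(nth_index x (_ : x \in s)) ?sE ?inE // e nth_index ?sE ?inE.
  - apply/forallP => i; apply/existsP; exists (nth (enum_val i) s i).
    have ilt : i < size s by rewrite (size_lin sl) cardsT.
    by rewrite -val_eqE /= ffun_of_seqE // index_uniq.
  - apply/forallP => x; apply/forallP => y; apply/implyP.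
    rewrite le_eqVlt => /predU1P[->//|lt]; rewrite !ffun_of_seqE //.
    by rewrite ltnW // (lin_index_lt sl) ?inE.
rewrite inE => /and3P[/injectiveP finj _ /forallP mono].
have [|g fK gK] := inj_card_bij finj; first by rewrite card_ord.
have idx x : index x [seq g i | i <- enum 'I_#|P|] = f x.
  by rewrite -[in LHS](fK x) index_map ?index_enum_ord //; exact: can_inj gK.
have sl : [seq g i | i <- enum 'I_#|P|] \in lin [set: P].
  apply/linP; split.
  - by rewrite map_inj_uniq ?enum_uniq //; exact: can_inj gK.
  - move=> y; rewrite inE; apply/mapP; exists (f y); first by rewrite mem_enum.
    by rewrite fK.
  - rewrite pairwise_map; have [n0|n0] := posnP #|P|.
      by case: (enum _) => // -[m lt] *; exfalso; move: lt; rewrite n0.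
    apply/(pairwiseP (Ordinal n0)) => i j; rewrite !inE size_enum_ord => i1 j1 ij.
    apply/negP => /ltW lt.
    pose e k := nth (Ordinal n0) (enum 'I_#|P|) k.
    have /forallP/(_ (g (e i)))/implyP/(_ lt) := mono (g (e j)).
    by rewrite !gK !nth_enum_ord // leqNgt ij.
exists [seq g i | i <- enum 'I_#|P|] => //.
by apply/ffunP => x; apply: val_inj; rewrite /= ffun_of_seqE // idx.
Qed.

Lemma sum_linext (V : nmodType) (F : {ffun P -> 'I_#|P|} -> V) :
  (\sum_(f in linext P) F f = \sum_(s <- lin [set: P]) F (ffun_of_seq s))%R.
Proof. by rewrite -big_enum (perm_big _ lin_linext) /= big_map. Qed.

Lemma card_linext : #|linext P| = nlin [set: P].
Proof. by rewrite cardE (perm_size lin_linext) size_map. Qed.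

Variable R : realFieldType.
Local Open Scope ring_scope.

Lemma prob_before x y :
  prob P R (fun f => (f x < f y)%N) = (before [set: P] x y)%:R / (nlin [set: P])%:R.
Proof.
rewrite /prob card_linext; congr (_%:R / _).
rewrite cardE (_ : enum _ =
  filter (fun f : {ffun P -> 'I_#|P|} => f x < f y)%N (enum (linext P))).
  rewrite size_filter (seq.permP lin_linext) count_map /before.
  by apply: eq_in_count => s sl /=; rewrite !ffun_of_seqE.
rewrite /enum_mem -filter_predI; apply: eq_filter => f /=.
by rewrite !inE andbC.
Qed.

Lemma height_sum x : height R x =
  (\sum_(s <- lin [set: P]) (index x s).+1)%N%:R / (nlin [set: P])%:R.
Proof.
rewrite /height /expect card_linext sum_linext natr_sum; congr (_ / _).
by rewrite big_seq [RHS]big_seq; apply: eq_bigr => s sl; rewrite ffun_of_seqE.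
Qed.

Lemma nlinR_gt0 : 0 < (nlin [set: P])%:R :> R.
Proof. by rewrite ltr0n nlin_gt0. Qed.

Lemma prob_compl x y : x != y ->
  prob P R (fun f => (f x < f y)%N) + prob P R (fun f => (f y < f x)%N) = 1.
Proof.
move=> xy; rewrite !prob_before -mulrDl -natrD before_compl ?inE // divff //.
by rewrite lt0r_neq0 ?nlinR_gt0.
Qed.

Lemma delta_le : delta P R <= 1 / 2.
Proof.
apply: bigmax_le => [|[x y] /= xy]; first by lra.
have := prob_compl xy; rewrite /delta2 ge_min.
by case: leP => //= h e; lra.
Qed.

Definition has_balanced_pair q : Prop := exists x y : P, balanced q [set: P] x y.

Lemma delta_ge q : has_balanced_pair q -> 1 / 2 - 2 / 2 ^+ q <= delta P R.
Proof.
move=> [x [y [_ _ xy b1 b2]]].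
have le1 : delta2 R x y <= delta P R.
  exact: (@le_bigmax_cond _ _ _ 0 (x, y) (fun p => p.1 != p.2)
            (fun p => delta2 R p.1 p.2)).
apply: le_trans le1.
have := before_compl (in_setT x) (in_setT y) xy => cE.
have n0 := nlinR_gt0; rewrite /delta2 !prob_before.
move: b1 b2 cE n0; move: (before _ x y) (before _ y x) (nlin _) => u v n.
move=> b1 b2 cE n0.
have toR (a b : nat) : (2 ^ q * a <= 2 ^ q * b + 4 * n)%N ->
    2 ^+ q * a%:R <= 2 ^+ q * b%:R + 4 * n%:R :> R.
  by rewrite -(ler_nat R) natrD !natrM natrX.
have {cE} cE : u%:R + v%:R = n%:R :> R by rewrite -natrD cE.
have p0 : 0 < 2 ^+ q :> R by rewrite exprn_gt0.
have bound (a b : R) : 2 ^+ q * a <= 2 ^+ q * b + 4 * n%:R -> a + b = n%:R ->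
    1 / 2 - 2 / 2 ^+ q <= b / n%:R.
  move=> h ab; rewrite ler_pdivlMr // -(ler_pM2l p0).
  have -> : 2 ^+ q * ((1 / 2 - 2 / 2 ^+ q) * n%:R) = 2 ^+ q * n%:R / 2 - 2 * n%:R :> R.
    by field; rewrite lt0r_neq0.
  by rewrite -ab mulrDr; rewrite -ab in h; lra.
rewrite le_min (bound v%:R) ?(bound u%:R) ?toR //.
by rewrite addrC.
Qed.

Lemma height_min_le x : x \in min_of [set: P] ->
  height R x * (nlin ([set: P] :\ x))%:R <= (nlin [set: P])%:R.
Proof.
move=> xm; rewrite height_sum mulrAC ler_pdivrMr ?nlinR_gt0 //.
by rewrite -!natrM ler_nat; have := sum_index_min xm; rewrite -mulnn.
Qed.

Lemma min_height_balanced q k : (2 * min_clump q <= 2 ^ k)%N ->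
  2 ^+ k <= min_height P R -> has_balanced_pair q.
Proof.
move=> hk hh.
have hx x : 2 ^+ k <= height R x by apply: le_trans hh _; exact: bigmin_le.
apply: (high_minimal_balanced (k := k)) => //.
  (* The empty poset is excluded because its [min_height] is 0, below 2^k. *)
  apply/set0Pn; have [p0|/card_gt0P[x _]] := posnP #|P|; last by exists x; rewrite inE.
  have : 2 ^+ k <= 0 :> R.
    by apply: le_trans hh _; apply: le_trans (bigmin_le_id _ _ _ _) _; rewrite p0.
  by rewrite leNgt exprn_gt0.
move=> x xm; rewrite -(ler_nat R) natrM natrX.
by apply: le_trans (height_min_le xm); apply: ler_wpM2r; rewrite ?ler0n.
Qed.

Lemma minimal_elements_min_of : minimal_elements P = min_of [set: P].
Proof.
by apply/setP => x; rewrite !inE; apply: eq_forallb => y; rewrite inE.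
Qed.

Lemma minimal_balanced q :
  (min_clump q * (trunc_log 2 #|P|).+1 <= #|minimal_elements P|)%N ->
  has_balanced_pair q.
Proof.
by rewrite minimal_elements_min_of -cardsT => /many_minimal_balanced.
Qed.

Lemma width_balanced q c : (#|P| <= c * width P)%N ->
  (wide_threshold q c <= #|P|)%N -> has_balanced_pair q.
Proof.
rewrite -cardsT => cw big; rewrite /width in cw.
have [|A Aac wE] :=
  @eq_bigmax_cond _ [pred A : {set P} | antichain A] (fun A => #|A|).
  by apply/card_gt0P; exists set0; rewrite inE; apply/antichainP => x; rewrite inE.
by rewrite wE in cw; apply: (wide_balanced (subsetT A)) cw big.
Qed.

Lemma chain_antichain_balanced_pair q (C A : {set P}) :
  is_disjoint_union C A -> chain C -> antichain A -> (chain_threshold q <= #|A|)%N ->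
  has_balanced_pair q.
Proof.
case/andP=> /eqP CA /eqP CA0; apply: chain_antichain_balanced => //.
by rewrite -setI_eq0 CA0.
Qed.

End Transfer.

(* Passage to the limit *)
From mathcomp Require Import all_classical all_reals all_analysis.
Import Order.TTheory GRing.Theory Num.Theory.
Import numFieldNormedType.Exports.
Local Open Scope classical_set_scope.
Local Open Scope ring_scope.

Theorem theorem1p4 (R : realType) (d : Order.disp_t) (P : nat -> finPOrderType d) :
  [\/ (* (a) *)
      ((fun m => #|P m|) @ \oo --> \oo) /\
      ((fun m => #|minimal_elements (P m)|%:R / ln (#|P m|%:R : R)) @ \oo --> +oo),
      (* (b) *)
      (fun m => min_height (P m) R) @ \oo --> +oo,
      (* (c) *)
      ((fun m => #|P m|) @ \oo --> \oo) /\
      (exists c : R, 0 < c /\ forall m, c * #|P m|%:R <= (width (P m))%:R) |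
      (* (d) *)
      exists C A : forall m, {set P m},
        (forall m, [/\ is_disjoint_union (C m) (A m),
                       chain (C m) &
                       antichain (A m)]) /\
        ((fun m => #|A m|) @ \oo --> \oo)] ->
  (fun m => delta (P m) R) @ \oo --> (1 / 2 : R).
Proof.
move=> cases.
suff bal q : \forall m \near \oo, @has_balanced_pair d (P m) q.
  apply/cvgrPdist_le => e e0.
  have [q hq] : exists q : nat, 2 / 2 ^+ q <= e.
    exists (Num.trunc (2 / e)).+1.
    rewrite ler_pdivrMr ?exprn_gt0 // mulrC -ler_pdivrMr //.
    apply: le_trans (ltW (truncnS_gt _)) _.
    by rewrite -natrX ler_nat ltnW // ltn_expl.
  near=> m.
  have b : @has_balanced_pair d (P m) q by near: m; exact: bal.
  have h1 := delta_ge R b; have h2 := @delta_le d (P m) R.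
  by rewrite ger0_norm ?subr_ge0 //; lra.
have oo_ge (f : nat -> nat) N : f @ \oo --> \oo -> \forall m \near \oo, (N <= f m)%N.
  by move/cvgnyPge; apply.
case: cases => [[cn cm]|ch|[cn [c [c0 cw]]]|[C [A [CA cA]]]].
- have l2 : 0 < ln 2 :> R by rewrite ln_gt0 // ltr1n.
  near=> m; apply: minimal_balanced.
  have n2 : (2 <= #|P m|)%N by near: m; exact: oo_ge.
  (* The 2 absorbs L + 1 <= 2 L, and [ln 2] converts the natural logarithm to base 2. *)
  have hm : (2 * min_clump q)%:R / ln 2 <= #|minimal_elements (P m)|%:R / ln (#|P m|%:R : R).
    by near: m; move/cvgryPge : cm; apply.
  have ln0 : 0 < ln (#|P m|%:R : R) by rewrite ln_gt0 // ltr1n.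
  set L := trunc_log 2 #|P m|.
  have /andP[L1 _] := trunc_log_bounds (isT : (1 < 2)%N) (ltnW n2).
  have Lpos : (0 < L)%N by rewrite trunc_log_gt0 /= n2.
  have hL : L%:R * ln 2 <= ln (#|P m|%:R : R).
    rewrite mulr_natl -lnXn // ler_ln ?posrE ?exprn_gt0 ?ltr0n //; last exact: ltnW.
    by rewrite -natrX ler_nat.
  rewrite -(ler_nat R); apply: (@le_trans _ _ ((2 * min_clump q)%:R * L%:R)).
    rewrite -natrM ler_nat mulnAC [leqRHS]mulnC leq_mul2l; apply/orP; right.
    by rewrite mul2n -addnn -addn1 leq_add2l.
  move: hm; rewrite ler_pdivlMr //; apply: le_trans.
  rewrite -mulrA; apply: ler_wpM2l => //.
  by rewrite ler_pdivlMl // mulrC.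
- have [k hk] : exists k, (2 * min_clump q <= 2 ^ k)%N.
    by exists (2 * min_clump q)%N; rewrite ltnW // ltn_expl.
  near=> m; apply: (min_height_balanced hk (R := R)).
  by near: m; move/cvgryPge : ch; apply.
(* An integer above 1/c turns the real width bound into the form n <= k w. *)
- have [k hk] : exists k : nat, c^-1 <= k%:R.
    by exists (Num.trunc c^-1).+1; exact: ltW (truncnS_gt _).
  near=> m; apply: (@width_balanced _ _ q k).
    rewrite -(ler_nat R) natrM.
    have := cw m; rewrite -ler_pdivlMl // => /le_trans; apply.
    exact: ler_wpM2r.
  by near: m; exact: oo_ge.
- near=> m; have [du Cc Aa] := CA m.
  apply: (chain_antichain_balanced_pair du Cc Aa).
  by near: m; exact: (oo_ge (fun m => #|A m|)).
Unshelve. all: by end_near.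
Qed.
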